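(* The theory $T=\operatorname{Th}(\mathbb{N},\cdot,1)$ has weak elimination of imaginaries; that is, for every $n$, every $\mathbb{M}$-definable set $D\subseteq\mathbb{M}^n$ has an almost canonical parameter.
   Context: $\mathbb{N}$ denotes the non-zero natural numbers, and $T$ is the complete first-order theory of the multiplicative monoid $(\mathbb{N},\cdot,1)$ (Skolem arithmetic). $\mathbb{M}\models T$ is a fixed monster model with $\mathbb{N}\prec\mathbb{M}$: a special structure of cardinality $\beth_{\mu^+}(\mu)$ for some suitably large cardinal $\mu$; ''small'' means of size $<\mu^+$. ''$B$-definable'' means definable by a first-order formula with parameters from $B$. Let $D\subseteq\mathbb{M}^n$ be $X$-definable for some finite set $X\subset\mathbb{M}$. Then $X$ is an almost canonical parameter for $D$ if $X$ is fixed setwise by every automorphism of $\mathbb{M}$ fixing $D$ setwise. *)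

(* Defs.v *)
From mathcomp Require Import all_boot wochoice all_classical.

Set Implicit Arguments.
Unset Strict Implicit.
Unset Printing Implicit Defensive.

Local Open Scope classical_set_scope.
Local Open Scope card_scope.

(** * First-order logic in the language of monoids *)

Record structure := Structure {
  dom :> Type;
  smul : dom -> dom -> dom;
  sone : dom }.

(* Variables range over an arbitrary type [V]; a quantifier binds [None] in
   [option V].  Sentences are formulas over [void], and a formula with free
   variables in [V] and parameters from [B] is a formula over [V + B]. *)
Inductive term (V : Type) : Type :=
  | Var of V
  | One
  | Mul of term V & term V.
Arguments One {V}.

Inductive formula (V : Type) : Type :=
  | Eq of term V & term V
  | Not of formula V
  | And of formula V & formula V
  | Ex of formula (option V).

Definition scons (T V : Type) (x : T) (e : V -> T) (v : option V) : T :=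
  if v is Some w then e w else x.

Fixpoint eval (M : structure) (V : Type) (e : V -> M) (t : term V) : M :=
  match t with
  | Var v => e v
  | One => sone M
  | Mul t1 t2 => smul (eval e t1) (eval e t2)
  end.

Fixpoint sat (M : structure) (V : Type) (e : V -> M) (f : formula V) : Prop :=
  match f with
  | Eq t1 t2 => eval e t1 = eval e t2
  | Not g => ~ sat e g
  | And g h => sat e g /\ sat e h
  | Ex g => exists x : M, sat (scons x e) g
  end.

Definition sentence := formula void.

Definition holds (M : structure) (f : sentence) : Prop :=
  sat (fun v : void => match v with end : M) f.

Definition Th (M : structure) : set sentence := [set f | holds M f].

Definition models (M : structure) (T : set sentence) : Prop :=
  forall f, T f -> holds M f.

Definition elementary (M N : structure) (h : M -> N) : Prop :=
  forall (V : Type) (e : V -> M) (f : formula V), sat e f <-> sat (h \o e) f.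

Definition automorphism (M : structure) (s : M -> M) : Prop :=
  [/\ bijective s, s (sone M) = sone M &
      forall x y, s (smul x y) = smul (s x) (s y)].

(** * Skolem arithmetic *)

Definition posnat := {n : nat | 0 < n}.

Definition posnat_one : posnat := exist _ 1 isT.

Lemma posnat_mul_subproof (x y : posnat) : 0 < val x * val y.
Proof. by rewrite muln_gt0 !valP. Qed.

Definition posnat_mul (x y : posnat) : posnat :=
  exist _ (val x * val y) (posnat_mul_subproof x y).

Definition NatMul : structure := Structure posnat_mul posnat_one.

Definition skolem_arithmetic : set sentence := Th NatMul.

(** * Special structures *)

Record substructure (M : structure) := Substructure {
  sub_set : set M;
  sub_one : sub_set (sone M);
  sub_mul : forall x y, sub_set x -> sub_set y -> sub_set (smul x y) }.

Definition sub_structure (M : structure) (S : substructure M) : structure :=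
  @Structure {x : M | sub_set S x}
    (fun x y => exist _ (smul (sval x) (sval y))
                        (sub_mul (svalP x) (svalP y)))
    (exist _ (sone M) (sub_one S)).

Definition elementary_sub (M : structure) (S S' : substructure M) : Prop :=
  exists h : sub_structure S -> sub_structure S',
    (forall x, sval (h x) = sval x) /\ elementary h.

Definition satisfies (M : structure) (P : set M) (x : M)
    (f : formula (unit + P)) : Prop :=
  sat (fun v => match v with inl _ => x | inr b => set_val b end) f.

(* [succ_saturated L M] is |L|^+-saturation: [P] is a set of parameters of
   cardinality < |L|^+, and [p] a set of formulas in one variable over [P]. *)
Definition succ_saturated (U : Type) (L : set U) (M : structure) : Prop :=
  forall P : set M, P #<= L ->
  forall p : set (formula (unit + P)),
    (forall q, q `<=` p -> finite_set q ->
       exists x : M, forall f, q f -> satisfies x f) ->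
    exists x : M, forall f, p f -> satisfies x f.

(* A specialising chain is indexed by the cardinals < |M|.  Each of these is
   the cardinality of some [A : set M] that [M] does not inject into, so the
   chain is indexed by such [A]; its monotonicity along [#<=] makes the
   underlying set of [N A] depend on |A| only. *)
Definition small_card (M : structure) (A : set M) : Prop :=
  ~ ([set: M] #<= A).

Definition special (M : structure) : Prop :=
  exists N : set M -> substructure M,
  [/\ infinite_set [set: M],
      forall A B, small_card A -> small_card B -> A #<= B ->
        elementary_sub (N A) (N B),
      forall A, small_card A -> succ_saturated A (sub_structure (N A)) &
      forall x : M, exists2 A, small_card A & sub_set (N A) x].

(** * The cardinal beth_{mu^+}(mu) *)

Section Beth.
Variables (I : Type) (R : rel I).

Definition below (i : I) : set I := [set j | R j i /\ j <> i].

(* [R] is a well-order of [I] whose order type is the initial ordinal mu^+. *)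
Definition succ_cardinal_order (mu : Type) : Prop :=
  [/\ well_order R,
      forall i, below i #<= [set: mu] &
      ~ ([set: I] #<= [set: mu])].

(* Every cardinal <= |K| is that of a subset of [K], so it is enough to compare
   [K] with those upper bounds. *)
Definition is_sup_card (J : set I) (F : I -> Type) (K : Type) : Prop :=
  (forall j, J j -> [set: F j] #<= [set: K]) /\
  (forall X : set K, (forall j, J j -> [set: F j] #<= X) -> [set: K] #<= X).

Definition is_pred (j i : I) : Prop :=
  below i j /\ forall k, below i k -> R k j.

(* |B i| = beth_i(mu) for every [i] *)
Definition beth_sequence (mu : Type) (B : I -> Type) : Prop :=
  [/\ forall i, below i = set0 -> [set: B i] #= [set: mu],
      forall i j, is_pred j i -> [set: B i] #= [set: set (B j)] &
      forall i, below i !=set0 -> (forall j, ~ is_pred j i) ->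
        is_sup_card (below i) B (B i)].

End Beth.

(* mu^+ is a limit ordinal, so beth_{mu^+}(mu) is the supremum of the
   beth_i(mu) for i < mu^+. *)
Definition has_card_beth_succ (mu K : Type) : Prop :=
  exists (I : Type) (R : rel I) (B : I -> Type),
    [/\ succ_cardinal_order R mu, beth_sequence R mu B &
        is_sup_card [set: I] B K].

Definition monster (mu : Type) (M : structure) : Prop :=
  [/\ models M skolem_arithmetic,
      exists h : NatMul -> M, elementary h,
      special M &
      has_card_beth_succ mu M].

(** * Weak elimination of imaginaries *)

Section Imaginaries.
Variables (M : structure) (n : nat).

Definition definable (B : set M) (D : set ('I_n -> M)) : Prop :=
  exists f : formula ('I_n + B),
    D = [set x | sat (fun v => match v with
                               | inl i => x i
                               | inr b => set_val b
                               end) f].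

Definition fixes_setwise (s : M -> M) (D : set ('I_n -> M)) : Prop :=
  [set s \o x | x in D] = D.

Definition almost_canonical_parameter (D : set ('I_n -> M)) (X : set M) :
    Prop :=
  [/\ finite_set X, definable X D &
      forall s : M -> M, automorphism s -> fixes_setwise s D -> s @` X = X].

End Imaginaries.

Definition weak_elimination_of_imaginaries (M : structure) : Prop :=
  forall (n : nat) (D : set ('I_n -> M)), definable [set: M] D ->
    exists X : set M, almost_canonical_parameter D X.

(* Main.v *)
Require Import Defs.
From mathcomp Require Import all_boot all_classical.

(** Unique factorisation turns a positive integer into a finitely supported
    function from the primes, called sites below, to the natural numbers, and
    an [m]-tuple of integers into a configuration: a finitely supported map
    from the sites to [m]-tuples of exponents.  Multiplication acts site by
    site, and a Feferman-Vaught argument ([feferman_vaught]) shows how little a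
    formula can see: for some colouring of the exponent tuples by finitely many
    colours, its truth only depends on how many sites have each colour, counted
    up to a fixed threshold.

    Fix a formula [phi(x, b)], and call [b] and [b'] equivalent when they define
    the same set.  The proof attaches to each [b] in the standard model a code,
    a tuple of elements such that
    - being a code of [b] is definable without parameters;
    - the code determines the class of [b] ([code_determines]);
    - only boundedly many tuples are codes of members of a given class
      ([code_bounded]).
    These are first-order properties, so they hold in every model of the theory
    ([uniform_coding]).  There, the entries of all the codes of members of the
    class of [b] form the set [X] that is wanted.  It is finite by the third
    property; the second one defines the set of [b] from the code of [b]; and
    [X] is described in terms of the class of [b] alone, so that an automorphism
    fixing the set of [b] fixes [X].

    The code is found as follows.  At a site [p], two values are similar when
    exchanging one for the other at [p], in any configuration, does not affect
    membership in the class of [b].  There are boundedly many similarity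
    classes, and listing their least elements greedily, for the lexicographic
    order, gives a list [zeta p] of values that depends on [p] and on the class
    only.  The class has a member all of whose values are in these lists
    ([painted]), that is, a colouring [J] of the sites by positions in a list.
    Then two sites are exchangeable when interchanging their colours, in any
    configuration, does not affect membership in the class.  This is an
    equivalence relation on the sites with boundedly many classes.  Inside such
    a class of sites the colouring can be permuted at will, so only the number
    of sites of each colour matters; and if two colours both occur very often in
    it, then a site can be changed from one to the other ([recolour]), so these
    numbers only matter up to a threshold ([E_of_similar]).  Hence the class of
    [b] is determined by the lists [zeta], by the partition of the sites into
    exchangeability classes, and by finitely many bits.  The partition is
    recorded by a labelling of its parts by finitely many labels, and it is the
    choice of the labels that makes the code unique only up to finitely many
    possibilities: this is why the elimination of imaginaries is a weak one. *)

Set Implicit Arguments.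
Unset Strict Implicit.
Unset Printing Implicit Defensive.

Local Open Scope classical_set_scope.

(** * Colourings of sites, compared by counting up to a threshold *)

Section Realized.
Variable S : eqType.

(** Counting up to [K] is phrased through the colours of tuples of distinct
    sites: a colour occurs [k] times or more when [nseq k c] is realised.
    Coarser colourings are then compared by composition ([similar_comp]),
    without summing numbers of sites. *)
Definition realizes (C : Type) (a : S -> C) (t : seq C) : Prop :=
  exists2 l, uniq l & map a l = t.

Definition similar (C : Type) (K : nat) (a a' : S -> C) : Prop :=
  forall t, size t <= K -> realizes a t <-> realizes a' t.

Lemma similar_sym C K (a a' : S -> C) : similar K a a' -> similar K a' a.
Proof. by move=> h t ht; split => /(h t ht). Qed.

Lemma similar_trans C K (a a' a'' : S -> C) :
  similar K a a' -> similar K a' a'' -> similar K a a''.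
Proof.
move=> h h' t ht; split => [/(h t ht)/(h' t ht)|/(h' t ht)/(h t ht)] //.
Qed.

Lemma similar_le C K K' (a a' : S -> C) :
  K <= K' -> similar K' a a' -> similar K a a'.
Proof. by move=> leK h t ht; apply: h; apply: leq_trans leK. Qed.

Lemma similar_comp C D K (g : C -> D) (a a' : S -> C) :
  similar K a a' -> similar K (fun s => g (a s)) (fun s => g (a' s)).
Proof.
have aux b b' : similar K b b' -> forall t, size t <= K ->
    realizes (fun s => g (b s)) t -> realizes (fun s => g (b' s)) t.
  move=> h t ht [l ul lt].
  have /(h (map b l)) : size (map b l) <= K.
    by rewrite size_map -(size_map (fun s => g (b s))) lt.
  case=> [[|l' ul' e]]; first by exists l.
  move=> _; exists l' => //; rewrite -lt.
  by rewrite -[LHS]/(map (g \o b') l') map_comp e -map_comp.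
by move=> h t ht; split; apply: aux => //; apply: similar_sym.
Qed.

Definition upd (T : Type) (c : S -> T) (p : S) (x : T) : S -> T :=
  fun s => if s == p then x else c s.

Lemma updE T (c : S -> T) p x : upd c p x p = x.
Proof. by rewrite /upd eqxx. Qed.

Lemma updN T (c : S -> T) p x s : s != p -> upd c p x s = c s.
Proof. by rewrite /upd => /negPf->. Qed.

Lemma upd_id T (c : S -> T) p : upd c p (c p) = c.
Proof. by apply/funext => s; rewrite /upd; case: eqP => // ->. Qed.

Definition transpose T (a : S -> T) p q := upd (upd a p (a q)) q (a p).

Lemma transposeK T (a : S -> T) p q : transpose (transpose a p q) p q = a.
Proof.
apply/funext => s; rewrite /transpose /upd !eqxx.
by case: eqP => [->|_]; case: eqP => [->|_].
Qed.

Lemma similar_transpose C K (a : S -> C) p q :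
  similar K a (transpose a p q).
Proof.
have aux b t : realizes b t -> realizes (transpose b p q) t.
  case=> l ul <-.
  pose g s := if s == p then q else if s == q then p else s.
  have gK : involutive g.
    move=> s; rewrite /g; case: (s =P p) => [->|/eqP sp].
      by rewrite eqxx; case: eqP.
    case: (s =P q) => [->|/eqP sq]; first by rewrite eqxx.
    by rewrite (negPf sp) (negPf sq).
  exists (map g l); first by rewrite map_inj_uniq //; apply: inv_inj.
  rewrite -map_comp; apply: eq_map => s /=; rewrite /g /transpose /upd.
  case: (s =P p) => [->|/eqP sp]; first by rewrite eqxx.
  case: (s =P q) => [->|/eqP sq].
    by case: (p =P q) => [->//|_]; rewrite eqxx.
  by rewrite (negPf sp) (negPf sq).
move=> t _; split; first exact: aux.
by move=> /aux; rewrite transposeK.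
Qed.

Lemma fresh_in (l k : seq S) : uniq l -> size k < size l ->
  exists2 s, s \in l & s \notin k.
Proof.
move=> ul h; have [/allP sub|/allPn[s sl sk]] := boolP (all (mem k) l).
  by move: h; rewrite ltnNge uniq_leq_size.
by exists s.
Qed.

Section Counting.
Variables (C : eqType) (a : S -> C).

Lemma count_mem_map c l : count_mem c (map a l) = size [seq s <- l | a s == c].
Proof. by rewrite count_map -size_filter. Qed.

Lemma realizes_of_count l t : uniq l ->
  (forall c, count_mem c t <= count_mem c (map a l)) ->
  exists k, [/\ uniq k, {subset k <= l} & map a k = t].
Proof.
move=> ul; elim: t => [|c t IH] h; first by exists [::].
have [|k [uk kl kt]] := IH.
  by move=> d; apply: leq_trans (h d); rewrite /= leq_addl.
have := h c; rewrite /= eqxx add1n -kt !count_mem_map => hc.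
have [|s] := fresh_in _ hc; first by rewrite filter_uniq.
rewrite !mem_filter => /andP[/eqP sc sl]; rewrite sc eqxx /= => sk.
exists (s :: k); split; rewrite /= ?sk ?sc ?kt //.
by move=> x; rewrite inE => /orP[/eqP->//|/kl].
Qed.

(** Either [l] has all the sites of a given colour, or it has [K] of them: as
    far as tuples of length [K] are concerned, [l] stands for all the sites. *)
Definition saturating K (l : seq S) : Prop :=
  forall s, s \notin l -> K <= count_mem (a s) (map a l).

Lemma count_saturating K l k c : saturating K l -> uniq k -> size k <= K ->
  count_mem c (map a k) <= count_mem c (map a l).
Proof.
move=> sat uk sk.
have [/allP sub|/allPn[s]] := boolP (all (mem l) [seq s <- k | a s == c]).
  rewrite !count_mem_map; apply: uniq_leq_size; first exact: filter_uniq.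
  move=> s sf; move: (sf); rewrite !mem_filter => /andP[-> _].
  exact: sub sf.
rewrite mem_filter => /andP[/eqP <- _] /sat; apply: leq_trans.
by apply: leq_trans (count_size _ _) _; rewrite size_map.
Qed.

End Counting.

Lemma similar_saturating (C : eqType) K (a a' : S -> C) l l' :
  uniq l -> uniq l' -> map a l = map a' l' ->
  saturating a K l -> saturating a' K l' -> similar K a a'.
Proof.
have aux (b b' : S -> C) k k' : uniq k' -> map b k = map b' k' ->
    saturating b K k -> forall t, size t <= K -> realizes b t -> realizes b' t.
  move=> uk' e sat t ht [h uh ht'].
  have sh : size h <= K by rewrite -(size_map b) ht'.
  have [|h' [uh' _ e']] := @realizes_of_count _ b' k' t uk'; last by exists h'.
  by move=> c; rewrite -ht' -e; apply: count_saturating sat _ _.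
move=> ul ul' e sl sl' t ht; split.
  exact: (aux a a' l l').
exact: (aux a' a l' l).
Qed.

Lemma size_count_mem (C : finType) (t : seq C) :
  size t = \sum_c count_mem c t.
Proof.
elim: t => [|c t IH] /=; first by rewrite big1.
rewrite big_split /= -IH (bigD1 c) //= eqxx big1 // => d /negPf.
by rewrite eq_sym => ->.
Qed.

(** A list having no colour more than [K] times, and of maximal length. *)
Lemma saturating_exists (C : finType) K (a : S -> C) :
  exists2 l, uniq l & size l <= K * #|C| /\ saturating a K l.
Proof.
have bound l : (forall c, count_mem c (map a l) <= K) -> size l <= K * #|C|.
  move=> h; rewrite -(size_map a) size_count_mem.
  rewrite mulnC -sum_nat_const.
  by apply: leq_sum => c _; apply: h.
suff aux n l : uniq l -> (forall c, count_mem c (map a l) <= K) ->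
    K * #|C| <= size l + n ->
    exists2 l, uniq l & size l <= K * #|C| /\ saturating a K l.
  by apply: (aux (K * #|C|) [::]).
elim: n l => [|n IH] l ul hl hn.
all: have [sat|] := pselect (saturating a K l); first by
       exists l => //; split => //; apply: bound.
all: move=> /existsNP[s /not_implyP[sl /negP]]; rewrite -ltnNge => hs.
all: have hl' c : count_mem c (map a (s :: l)) <= K by
       rewrite /=; case: eqP => [<-|_]; rewrite ?add1n // add0n.
- by have := bound _ hl'; rewrite /= ltnNge -(addn0 (size l)) hn.
- by apply: (IH (s :: l)); rewrite /= ?sl // addSnnS.
Qed.

(** The forth step of a back-and-forth: outside [l], [a] still has a site of
    the colour [a' s'], since the list [s' :: l'] is realised in [a] too. *)
Lemma similar_extend (C : eqType) K (a a' : S -> C) l l' s' :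
  similar K a a' -> size l < K -> uniq l' -> map a l = map a' l' ->
  s' \notin l' -> exists2 s, s \notin l & a s = a' s'.
Proof.
move=> h sl ul' e s'l'.
have /h [] : size (map a' (s' :: l')) <= K by rewrite /= -e size_map.
move=> _ [|k uk ek]; first by exists (s' :: l') => //=; rewrite s'l'.
have : count_mem (a' s') (map a l) < count_mem (a' s') (map a k).
  by rewrite ek /= eqxx e.
rewrite !count_mem_map => hc.
have [|s] := fresh_in _ hc; first exact: filter_uniq.
by rewrite !mem_filter => /andP[/eqP es _]; rewrite es eqxx /=; exists s.
Qed.

Lemma realizes_nseq (C : eqType) (a : S -> C) k c :
  realizes a (nseq k c) <->
  exists l, [/\ uniq l, size l = k & forall s, s \in l -> a s = c].
Proof.
split=> [[l ul e]|[l [ul <- h]]].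
  exists l; split; rewrite // -?(size_map a) ?e ?size_nseq // => s sl.
  by have := map_f a sl; rewrite e mem_nseq => /andP[_ /eqP].
exists l => //; elim: l h {ul} => //= s l IH h.
by rewrite h ?inE ?eqxx // IH // => x xl; apply: h; rewrite inE xl orbT.
Qed.

(** Changing the colour of one site goes unnoticed when its old colour and its
    new one both occur [K] times elsewhere: in a tuple that uses the site, an
    unused site of the right colour can replace it. *)
Lemma similar_upd (C : eqType) K (a : S -> C) p c l1 l2 :
  uniq l1 -> K <= size l1 -> (forall s, s \in l1 -> s != p /\ a s = a p) ->
  uniq l2 -> K <= size l2 -> (forall s, s \in l2 -> s != p /\ a s = c) ->
  similar K a (upd a p c).
Proof.
have aux (b : S -> C) d l : uniq l -> K <= size l ->
    (forall s, s \in l -> s != p /\ b s = b p) -> forall t, size t <= K ->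
    realizes b t -> realizes (upd b p d) t.
  move=> ul Kl hl t ht [k uk e].
  have [pk|pk] := boolP (p \in k); last first.
    exists k => //; rewrite -e; apply/eq_in_map => s sk; rewrite updN //.
    by apply: contraNneq pk => <-.
  have : size (rem p k) < size l.
    rewrite size_rem // prednK; last by case: (k) pk.
    by rewrite -(size_map b) e (leq_trans ht).
  case/(fresh_in ul) => q /hl[qp bq]; rewrite mem_rem_uniq // inE qp /= => qk.
  pose g s := if s == p then q else s.
  exists (map g k).
    rewrite map_inj_in_uniq // => x y xk yk; rewrite /g.
    case: (x =P p) => [->|_]; case: (y =P p) => [->|_] // ee.
      by rewrite ee yk in qk.
    by rewrite -ee xk in qk.
  rewrite -e -map_comp; apply/eq_in_map => s sk /=; rewrite /g.
  by case: (s =P p) => [->|/eqP sp]; rewrite updN.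
move=> ul1 K1 h1 ul2 K2 h2 t ht; split; first exact: aux h1 _ _.
have -> : realizes a t = realizes (upd (upd a p c) p (a p)) t.
  by congr realizes; apply/funext => s; rewrite /upd; case: eqP => // ->.
apply: (aux _ _ l2) => // s /h2[sp sc].
by rewrite updE updN.
Qed.

End Realized.

(** * The standard model, seen site by site *)

Definition finitely_supported (S : eqType) T (d : T) (f : S -> T) : Prop :=
  exists l : seq S, forall s, s \notin l -> f s = d.

Definition site := {p : nat | prime p}.

Definition val_at (x : NatMul) (s : site) : nat := logn (val s) (val x).

Lemma val_at_mul x y s : val_at (smul x y) s = val_at x s + val_at y s.
Proof. by rewrite /val_at /= lognM ?valP. Qed.

Lemma val_at_one s : val_at (sone NatMul) s = 0.
Proof. exact: logn1. Qed.

Lemma val_at_inj x y : val_at x =1 val_at y -> x = y.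
Proof.
move=> h; apply: val_inj; apply: eqn_from_log; rewrite ?(valP x) ?(valP y) //.
move=> p; case pp: (prime p); first exact: (h (exist _ p pp)).
by rewrite /logn pp.
Qed.

Lemma val_at_fs x : finitely_supported 0 (val_at x).
Proof.
exists (pmap insub (primes (val x))) => s.
rewrite mem_pmap_sub mem_primes (valP s) (valP x) /= => h.
by rewrite /val_at lognE (valP s) (valP x) (negPf h).
Qed.

Lemma val_at_surj (f : site -> nat) :
  finitely_supported 0 f -> exists x, forall s, val_at x s = f s.
Proof.
case=> l hl; pose n := \prod_(s <- undup l) val s ^ f s.
have n0 : 0 < n.
  by rewrite /n prodn_gt0 // => s; rewrite expn_gt0 prime_gt0 ?valP.
exists (exist _ n n0) => s; rewrite /val_at /= /n.
have -> : logn (val s) n = \sum_(t <- undup l) logn (val s) (val t ^ f t).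
  rewrite /n; elim: (undup l) => [|t k IH]; first by rewrite !big_nil logn1.
  have pos u : 0 < val u ^ f u by rewrite expn_gt0 prime_gt0 // (valP u).
  by rewrite !big_cons lognM ?IH // prodn_gt0.
have step t : logn (val s) (val t ^ f t) = if t == s then f s else 0.
  rewrite lognX; case: eqP => [->|/eqP ts].
    by rewrite logn_prime ?valP // eqxx muln1.
  rewrite logn_prime ?valP //; case: eqP => [e|]; last by rewrite muln0.
  by move: ts; rewrite -(inj_eq val_inj) -e eqxx.
rewrite (eq_bigr _ (fun t _ => step t)) -big_mkcond big_const_seq.
have [sl|sl] := boolP (s \in l).
  rewrite (_ : count _ _ = 1) /= ?addn0 //.
  by rewrite (count_uniq_mem s (undup_uniq l)) mem_undup sl.
by rewrite (hl s) //; elim: count.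
Qed.

Lemma site_infinite (l : seq site) : exists s, s \notin l.
Proof.
have [p ltp pp] := prime_above (\max_(s <- l | xpredT s) val s).
exists (exist _ p pp); apply: contraL ltp => sl; rewrite -leqNgt.
exact: (@leq_bigmax_seq _ l xpredT (fun s : site => val s) _ sl isT).
Qed.

Section FefermanVaught.

Definition local V (e : V -> NatMul) (s : site) : V -> nat :=
  fun w => val_at (e w) s.

Lemma local_scons V (e : V -> NatMul) x s :
  local (scons x e) s = scons (val_at x s) (local e s).
Proof. by apply/funext => -[]. Qed.

Definition NatAdd : structure := Structure addn 0.

Lemma eval_local V (e : V -> NatMul) t s :
  val_at (eval e t) s = @eval NatAdd _ (local e s) t.
Proof.
by elim: t => [w||t1 IH1 t2 IH2] //=; rewrite ?val_at_one // val_at_mul IH1 IH2.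
Qed.

Notation zero := (fun _ => 0).

(** By induction on the formula, only the quantifier being difficult.  There a
    tuple is coloured by the set of colours that it can take once a last
    coordinate has been added.  Given a witness [x] for [e], one takes a list
    [l] that stands for all the sites in the colouring of [scons x e], matches
    it with a list [l'] of sites for [e'], copies the colours of [l] to [l'],
    and gives to every other site a colour that occurs [K] times in [l].  The
    last coordinate is chosen to be zero wherever [e'] vanishes off [l'], which
    makes it finitely supported; this is possible because infinitely many sites
    have the colour [c0] of the zero tuple. *)
Lemma feferman_vaught V (f : formula V) :
  exists (C : finType) (cell : (V -> nat) -> C) (K : nat),
  forall e e', finitely_supported zero (local e) ->
    finitely_supported zero (local e') ->
    similar K (fun s => cell (local e s)) (fun s => cell (local e' s)) ->
    sat (M := NatMul) e f -> sat (M := NatMul) e' f.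
Proof.
elim: V / f => [V t1 t2|V f [C [cell [K IH]]]|
  V f [C [cell [K IH]]] g [D [cell' [L IH']]]|V f [C [cell [K IH]]]].
- exists bool, (fun u => @eval NatAdd _ u t1 != @eval NatAdd _ u t2), 1.
  move=> e e' _ _ h /= eq1; apply: val_at_inj => s; apply/eqP.
  apply/negPn/negP => ne; have [//|_ []] := h [:: true].
    by exists [:: s]; rewrite //= -!eval_local ne.
  by case=> [|s' [|//]] //= _ []; rewrite -!eval_local eq1 eqxx.
- exists C, cell, K => e e' fe fe' h /= nf sf; apply: nf.
  exact: IH (similar_sym h) sf.
- exists (C * D)%type, (fun u => (cell u, cell' u)), (maxn K L).
  move=> e e' fe fe' h /= [sf sg]; split.
    apply: IH sf => //; apply: similar_le (leq_maxl K L) _.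
    exact: (similar_comp fst h).
  apply: IH' sg => //; apply: similar_le (leq_maxr K L) _.
  exact: (similar_comp snd h).
pose T (u : V -> nat) : {ffun C -> bool} :=
  [ffun c => `[< exists n, cell (scons n u) = c >]].
(* One more than the length of [l], to match a further site outside [l]. *)
exists {ffun C -> bool}, T, (K * #|C|).+1.
move=> e e' fe fe' h /= [x sx].
pose a s := cell (scons (val_at x s) (local e s)).
have inT u n : T u (cell (scons n u)) by rewrite ffunE; apply/asboolP; exists n.
have ofT u c : T u c -> exists n, cell (scons n u) = c.
  by rewrite ffunE => /asboolP.
have [l ul [sl satl]] := saturating_exists K a.
have /h[+] : size [seq T (local e s) | s <- l] <= (K * #|C|).+1.
  by rewrite size_map leqW.
case=> [|l' ul' el']; first by exists l.
move=> _.
have ll : size l = size l'.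
  by rewrite -(size_map (fun s => T (local e s)) l) -el' size_map.
case: (fe) => supp hsupp; case: (fe') => supp' hsupp'.
have [suppx hx] := val_at_fs x.
pose c0 := cell (scons 0 zero).
have sat0 : K <= count_mem c0 (map a l).
  have [s] := site_infinite (l ++ supp ++ suppx).
  rewrite !mem_cat !negb_or => /and3P[sl1 /hsupp es /hx xs].
  by have := satl s sl1; rewrite /a es xs.
have /choice[f' hf'] : forall s, exists n,
    [/\ s \in l' -> cell (scons n (local e' s)) = nth c0 (map a l) (index s l'),
        s \notin l' -> K <= count_mem (cell (scons n (local e' s))) (map a l) &
        s \notin l' -> s \notin supp' -> n = 0].
  move=> s.
  have [sl'|sl'] := boolP (s \in l').
    have [|n hn] := ofT (local e' s) (nth c0 (map a l) (index s l')); last first.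
      by exists n; split.
    have lti : index s l' < size l by rewrite ll index_mem.
    have := congr1 (fun t => nth (T zero) t (index s l')) el'.
    rewrite (nth_map s) -?ll // (nth_map s) // nth_index // => ->.
    by rewrite (nth_map s) //; apply: inT.
  have [ss|ss] := boolP (s \in supp'); last first.
    by exists 0; split => // _; rewrite hsupp'.
  have [|s0 s0l es0] := similar_extend h _ ul' (esym el') sl'.
    by rewrite ltnS.
  have [|n hn] := ofT (local e' s) (a s0); first by rewrite -es0; apply: inT.
  exists n; split => // _; rewrite ?hn ?satl // ss.
have [|x' hx'] := @val_at_surj f'.
  exists (l' ++ supp') => s; rewrite mem_cat negb_or => /andP[s1 s2].
  by case: (hf' s) => _ _; apply.
exists x'; apply: IH sx.
- exists (supp ++ suppx) => s.
  rewrite mem_cat negb_or => /andP[/hsupp s1 /hx s2].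
  by rewrite local_scons s1 s2; apply/funext => -[].
- have [suppx' hx''] := val_at_fs x'.
  exists (supp' ++ suppx') => s.
  rewrite mem_cat negb_or => /andP[/hsupp' s1 /hx'' s2].
  by rewrite local_scons s1 s2; apply/funext => -[].
have e1 : (fun s => cell (local (scons x e) s)) = a.
  by apply/funext => s; rewrite local_scons.
pose a' s := cell (scons (f' s) (local e' s)).
have e2 : (fun s => cell (local (scons x' e') s)) = a'.
  by apply/funext => s; rewrite local_scons hx'.
have ea : map a l = map a' l'.
  apply: (@eq_from_nth _ c0); rewrite ?size_map // => i il.
  have [s0 _] := site_infinite [::].
  have il' : i < size l' by move: il; rewrite ?size_map -ll.
  rewrite [RHS](nth_map s0) //.
  have [/(_ (mem_nth s0 il')) + _ _] := hf' (nth s0 l' i).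
  by rewrite index_uniq // /a' => ->.
rewrite e1 e2; apply: (similar_saturating ul ul' ea satl) => s sl'.
by rewrite -ea; case: (hf' s) => _ + _; apply.
Qed.
End FefermanVaught.

(** * Greedy lists of representatives *)

Section Support.
Variables (S : eqType) (T : Type) (d : T).

Lemma fs_upd (c : S -> T) p x :
  finitely_supported d c -> finitely_supported d (upd c p x).
Proof.
case=> l hl; exists (p :: l) => s; rewrite inE negb_or => /andP[sp sl].
by rewrite updN // hl.
Qed.

Lemma fs_transpose (c : S -> T) p q :
  finitely_supported d c -> finitely_supported d (transpose c p q).
Proof. by move=> h; do 2!apply: fs_upd. Qed.

Lemma fs_diff (c c' : S -> T) :
  finitely_supported d c -> finitely_supported d c' ->
  exists2 l, uniq l & forall s, s \notin l -> c s = c' s.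
Proof.
move=> [l hl] [l' hl']; exists (undup (l ++ l')); first exact: undup_uniq.
by move=> s; rewrite mem_undup mem_cat negb_or => /andP[/hl-> /hl'->].
Qed.

End Support.

Section Greedy.
Variables (V : Type) (zero : V) (lt : V -> V -> Prop).
Hypothesis lt_least : forall A : V -> Prop, (exists v, A v) ->
  exists2 v, A v & forall w, A w -> w = v \/ lt v w.
Hypothesis lt_asym : forall v w, lt v w -> ~ lt w v.
Hypothesis zero_least : forall v, v = zero \/ lt zero v.

(** Each entry of the list is the least element not related to an earlier one,
    until every element is related to an entry; the list is then padded with
    [zero].  The padding gives all lists the same length, so that a position in
    the list makes sense at every site. *)
Definition greedy r (R : V -> V -> Prop) (z : 'I_r -> V) : Prop :=
  forall j : 'I_r,
    ((forall i : 'I_r, i < j -> ~ R (z j) (z i)) /\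
     (forall v, lt v (z j) -> exists2 i : 'I_r, i < j & R v (z i))) \/
    ((forall v, exists2 i : 'I_r, i < j & R v (z i)) /\ z j = zero).

Lemma greedy_exists r R : exists z : 'I_r -> V, greedy R z.
Proof.
pose G (z : nat -> V) j :=
    ((forall i, i < j -> ~ R (z j) (z i)) /\
     (forall v, lt v (z j) -> exists2 i, i < j & R v (z i))) \/
    ((forall v, exists2 i, i < j & R v (z i)) /\ z j = zero).
suff [z hz] : exists z, forall j, j < r -> G z j.
  exists (fun i => z i) => j.
  case: (hz j (ltn_ord j)) => -[h1 h2]; [left|right]; split=> //.
  - by move=> i; apply: h1.
  - move=> v /h2[i ij Ri].
    by exists (Ordinal (ltn_trans ij (ltn_ord j))).
  - move=> v; have [i ij Ri] := h1 v.
    by exists (Ordinal (ltn_trans ij (ltn_ord j))).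
elim: (r) => [|n [z hz]]; first by exists (fun=> zero).
suff [x hx] : exists x, G (fun k => if k == n then x else z k) n.
  exists (fun k => if k == n then x else z k) => j.
  rewrite ltnS leq_eqVlt => /orP[/eqP->//|jn].
  have old i : i <= j -> (if i == n then x else z i) = z i.
    by move=> ij; rewrite ltn_eqF // (leq_ltn_trans ij).
  case: (hz j jn) => -[h1 h2]; [left|right]; rewrite old //; split=> //.
  - by move=> i ij; rewrite old; [apply: h1|apply: ltnW].
  - by move=> v /h2[i ij Ri]; exists i => //; rewrite old // ltnW.
  - by move=> v; have [i ij Ri] := h1 v; exists i => //; rewrite old // ltnW.
have old x i : i < n -> (if i == n then x else z i) = z i.
  by move=> ij; rewrite ltn_eqF.
have [h|] := pselect (exists v, forall i, i < n -> ~ R v (z i)).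
  have [x hx1 hx2] := lt_least h.
  exists x; left; rewrite eqxx; split.
    by move=> i ij; rewrite old //; apply: hx1.
  move=> v ltvx; apply: contrapT => nR.
  have /hx2[e|] : forall i, i < n -> ~ R v (z i).
  - by move=> i ij Ri; apply: nR; exists i => //; rewrite old.
  - by rewrite e in ltvx; apply: (lt_asym ltvx).
  - exact: lt_asym.
move=> /forallNP h; exists zero; right; rewrite eqxx; split=> // v.
have /existsNP[i /not_implyP[ij /contrapT Ri]] := h v.
by exists i => //; rewrite old.
Qed.

Lemma greedy_nlt r R (z z' : 'I_r -> V) (j : 'I_r) :
  (forall i : 'I_r, i < j -> z i = z' i) ->
  greedy R z -> greedy R z' -> ~ lt (z' j) (z j).
Proof.
move=> e hz hz'; case: (hz j) => -[h1 h2].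
  move=> /h2[i ij]; rewrite e // => Ri.
  case: (hz' j) => -[g1 g2]; first exact: (g1 i).
  by have [k kj] := g1 (z j); rewrite -e //; apply: h1.
rewrite h2 => ltz; case: (zero_least (z' j)) => [e0|]; last exact: lt_asym ltz.
by rewrite e0 in ltz; apply: (lt_asym ltz).
Qed.

Lemma greedy_unique r R (z z' : 'I_r -> V) :
  greedy R z -> greedy R z' -> z = z'.
Proof.
move=> hz hz'; apply/funext => j.
have [n] := ubnP (nat_of_ord j); elim: n j => // n IH j; rewrite ltnS => jn.
have e (i : 'I_r) : i < j -> z i = z' i.
  by move=> ij; apply: IH; apply: leq_trans ij jn.
have e' (i : 'I_r) : i < j -> z' i = z i by move=> /e.
have nlt := greedy_nlt e hz hz'; have nlt' := greedy_nlt e' hz' hz.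
have [|v [->|->] h] := @lt_least (fun v => v = z j \/ v = z' j).
- by exists (z j); left.
- by case: (h (z' j)); [right|move=> <-|].
- by case: (h (z j)); [left|move=> <-|].
Qed.

Lemma greedy_ord0 r R (z : 'I_r.+1 -> V) : greedy R z -> z ord0 = zero.
Proof.
move=> /(_ ord0)[[_ h]|[_ ->//]].
by case: (zero_least (z ord0)) => // /h[i]; rewrite ltn0.
Qed.

Section Cells.
Variables (C : finType) (c : V -> C) (R : V -> V -> Prop).
Hypothesis R_sym : forall v w, R v w -> R w v.
Hypothesis R_trans : forall u v w, R u v -> R v w -> R u w.
Hypothesis R_cell : forall v w, c v = c w -> R v w.

Lemma greedy_cover r (z : 'I_r -> V) : #|C| < r -> greedy R z ->
  forall v, exists j, R v (z j).
Proof.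
move=> ltr hz v; apply: contrapT => /forallNP nv.
suff /leq_card : injective (fun j => c (z j)) by rewrite card_ord leqNgt ltr.
have main (i j : 'I_r) : i < j -> c (z j) <> c (z i).
  move=> ij /R_cell; case: (hz j) => -[h1 _]; first exact: h1.
  by have [k _ /nv] := h1 v.
move=> i j /= e; apply: val_inj; case: (ltngtP i j) => // /main; rewrite e //.
Qed.

(** Up to padding, an entry is least in its cell, not only among the elements
    left over by the earlier entries: hence, for all the relations coarser than
    the same finitely many cells, only finitely many elements can be entries. *)
Lemma greedy_cell_least r (z : 'I_r -> V) j : greedy R z ->
  z j = zero \/ forall w, c w = c (z j) -> ~ lt w (z j).
Proof.
move=> /(_ j)[[h1 h2]|[_ ->]]; [right|by left].
move=> w /R_cell Rw /h2[i ij Ri]; apply: (h1 i ij).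
exact: R_trans (R_sym Rw) Ri.
Qed.

End Cells.

Lemma cell_least (C : finType) (c : V -> C) :
  exists mu : C -> V, forall v,
    (forall w, c w = c v -> ~ lt w v) -> v = mu (c v).
Proof.
have /choice[mu hmu] : forall d, exists v, (exists w, c w = d) ->
    c v = d /\ forall w, c w = d -> w = v \/ lt v w.
  move=> d; have [h|h] := pselect (exists w, c w = d); last by exists zero.
  by have [v hv1 hv2] := lt_least h; exists v.
exists mu => v hv; have [|e /(_ v erefl)[]] // := hmu (c v); first by exists v.
by move=> /(hv _ e).
Qed.

End Greedy.

(** * Classes of configurations *)

(** [E] is an equivalence relation between configurations that only depends on
    the number, up to [K], of sites of each colour [cell (b s) (c s)].  By
    [feferman_vaught] the relation of defining the same set is of this kind. *)
Section Classes.
Variable S : eqType.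
Hypothesis S_infinite : forall l : seq S, exists s, s \notin l.
Variables (V : Type) (zero : V).
Local Notation fs := (finitely_supported zero).
Variable E : (S -> V) -> (S -> V) -> Prop.
Hypothesis E_refl : forall b, E b b.
Hypothesis E_sym : forall b c, E b c -> E c b.
Hypothesis E_trans : forall b c d, E b c -> E c d -> E b d.
Variables (C : finType) (cell : V -> V -> C) (K : nat).
Hypothesis E_local : forall b c c', fs b -> fs c -> fs c' ->
  similar K (fun s => cell (b s) (c s)) (fun s => cell (b s) (c' s)) ->
  E b c -> E b c'.

Definition sim (b : S -> V) (p : S) (v w : V) : Prop :=
  forall c c', fs c -> fs c' -> (forall q, q != p -> c q = c' q) ->
    c p = v -> c' p = w -> (E b c <-> E b c').

Lemma simP b p v w : (forall c, fs c -> E b (upd c p v) <-> E b (upd c p w)) ->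
  sim b p v w.
Proof.
move=> h c c' fc fc' e ev ew.
have := h c fc; rewrite -ev -ew upd_id (_ : upd c p (c' p) = c') //.
by apply/funext => s; rewrite /upd; case: eqP => [->//|/eqP/e].
Qed.

Lemma sim_upd b p v w : sim b p v w ->
  forall c, fs c -> E b (upd c p v) <-> E b (upd c p w).
Proof.
move=> h c fc; apply: h; rewrite ?updE //; do ?exact: fs_upd.
by move=> q qp; rewrite !updN.
Qed.

Lemma sim_refl b p v : sim b p v v.
Proof. exact: simP. Qed.

Lemma sim_sym b p v w : sim b p v w -> sim b p w v.
Proof. by move=> h; apply: simP => c fc; rewrite (sim_upd h). Qed.

Lemma sim_trans b p u v w : sim b p u v -> sim b p v w -> sim b p u w.
Proof.
by move=> h h'; apply: simP => c fc; rewrite (sim_upd h) // (sim_upd h').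
Qed.

Lemma E_iff b c c' : fs b -> fs c -> fs c' ->
  similar K (fun s => cell (b s) (c s)) (fun s => cell (b s) (c' s)) ->
  E b c <-> E b c'.
Proof.
by move=> fb fc fc' h; split; apply: E_local => //; apply: similar_sym.
Qed.

Lemma sim_cell b p v w : fs b -> cell (b p) v = cell (b p) w -> sim b p v w.
Proof.
move=> fb e; apply: simP => c fc; apply: E_iff => //; do ?exact: fs_upd.
rewrite (_ : (fun s => _) = fun s => cell (b s) (upd c p v s)) //.
by apply/funext => s; rewrite /upd; case: eqP => // ->.
Qed.

Lemma E_congr b b' : E b b' -> E b = E b'.
Proof.
move=> e; apply/funext => c; apply/propext; split; apply: E_trans => //.
exact: E_sym.
Qed.

Lemma sim_congr b b' : E b b' -> sim b = sim b'.
Proof. by rewrite /sim => /E_congr->. Qed.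

Lemma E_transpose b p q c : fs b -> fs c -> b p = b q ->
  E b c <-> E b (transpose c p q).
Proof.
move=> fb fc e; apply: E_iff => //; first exact: fs_transpose.
rewrite (_ : (fun s => cell _ (transpose _ _ _ _)) =
  transpose (fun s => cell (b s) (c s)) p q); first exact: similar_transpose.
apply/funext => s; rewrite /transpose /upd.
by case: eqP => [->|_]; rewrite ?e //; case: eqP => [->|]; rewrite ?e.
Qed.

(** Similarity at a site only depends on the value of [b] there, because
    interchanging two sites where [b] has the same value preserves the class.
    In particular it is the same at all the sites outside the support. *)
Lemma sim_generic b p q : fs b -> b p = b q -> sim b p = sim b q.
Proof.
suff aux p' q' v w : fs b -> b p' = b q' -> sim b p' v w -> sim b q' v w.
  move=> fb e; apply/funext => v; apply/funext => w; apply/propext.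
  by split; apply: aux.
move=> fb e; have [->//|/eqP pq] := p' =P q'.
move=> h c c' fc fc' ecc' cq c'q.
rewrite (E_transpose fb fc e) (E_transpose fb fc' e).
apply: h; rewrite /transpose /upd ?eqxx ?(negPf pq) //; do ?exact: fs_transpose.
by move=> s /negPf->; case: eqP => [_|/eqP/ecc' //]; apply: ecc'.
Qed.

(** Finitely many sites are concerned, and they can be changed one at a time. *)
Lemma sim_all b c c' : fs c -> fs c' -> (forall p, sim b p (c p) (c' p)) ->
  E b c <-> E b c'.
Proof.
move=> fc fc' h; have [l _] := fs_diff fc fc'.
elim: l c fc h => [|s l IH] c fc h e.
  by rewrite (_ : c = c') //; apply/funext => s; apply: e.
rewrite -(IH (upd c s (c' s))).
- by rewrite -{1}(upd_id c s); apply: sim_upd.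
- exact: fs_upd.
- by move=> p; rewrite /upd; case: eqP => [->|_]; [apply: sim_refl|apply: h].
- move=> t tl; rewrite /upd; case: eqP => [->//|/eqP ts].
  by apply: e; rewrite inE negb_or ts.
Qed.

Section Colours.
Variables (r : nat) (zeta : S -> 'I_r.+1 -> V).

(** [zeta p] lists values at [p], and the position of a value in the list is
    its colour; colours are interchanged, rather than values, because values at
    different sites cannot be compared in a definable way.  The other values of
    [c] and [c'] are arbitrary, and need not be in the lists. *)
Definition swappable (b : S -> V) (p q : S) : Prop :=
  forall i j c c', fs c -> fs c' ->
    (forall s, s != p -> s != q -> c s = c' s) ->
    c p = zeta p i -> c q = zeta q j -> c' p = zeta p j -> c' q = zeta q i ->
    (E b c <-> E b c').

Definition exchangeable b p q := p = q \/ swappable b p q.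

Lemma swappable_congr b b' : E b b' -> swappable b = swappable b'.
Proof. by rewrite /swappable => /E_congr->. Qed.

Lemma swappable_sym b p q : swappable b p q -> swappable b q p.
Proof.
move=> h i j c c' fc fc' e cp cq c'p c'q.
by apply: (h j i) => // s sp sq; apply: e.
Qed.

(** Interchanging the colours only permutes the colours [cell (b s) (c s)]. *)
Lemma swappable_cell b p q : fs b -> p != q ->
  (forall j, cell (b p) (zeta p j) = cell (b q) (zeta q j)) ->
  swappable b p q.
Proof.
move=> fb pq ecell i j c c' fc fc' e cp cq c'p c'q; apply: E_iff => //.
rewrite (_ : (fun s => cell _ (c' s)) =
  transpose (fun s => cell (b s) (c s)) p q); first exact: similar_transpose.
apply/funext => s; rewrite /transpose /upd.
case: eqP => [->|/eqP sq]; first by rewrite c'q cp ecell.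
case: eqP => [->|/eqP sp]; first by rewrite c'p cq ecell.
by rewrite e.
Qed.

(** The interchange of [p] and [t] is the composite of the interchanges of [p]
    and [q], [q] and [t], [p] and [q].  The value at [q] is first replaced by a
    similar one in the list, so that [q] has a colour. *)
Lemma swappable_trans b p q t :
  (forall v, exists k, sim b q v (zeta q k)) ->
  p != q -> q != t -> p != t ->
  swappable b p q -> swappable b q t -> swappable b p t.
Proof.
move=> cover pq qt pt hpq hqt i j c c' fc fc' e cp ct c'p c't.
have [k hk] := cover (c q).
have ecq : c q = c' q by apply: e; rewrite // eq_sym.
have h1 : E b c <-> E b (upd c q (zeta q k)).
  by rewrite -{1}(upd_id c q); apply: sim_upd.
have h4 : E b c' <-> E b (upd c' q (zeta q k)).
  by rewrite -{1}(upd_id c' q) -ecq; apply: sim_upd.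
pose c2 := upd (upd c p (zeta p k)) q (zeta q i).
pose c3 := upd (upd c2 q (zeta q j)) t (zeta t i).
have h2 : E b (upd c q (zeta q k)) <-> E b c2.
  apply: (hpq i k); rewrite /c2 ?updE //; do ?exact: fs_upd.
  - by do 2!apply: fs_upd.
  - by move=> s sp sq; rewrite !updN.
  - by rewrite updN.
  - by rewrite updN ?updE.
have h3 : E b c2 <-> E b c3.
  apply: (hqt i j); rewrite /c3 /c2 ?updE //; do ?[exact: fs_upd|apply: fs_upd].
  - by move=> s sq st; rewrite (updN _ _ st) [RHS](updN _ _ sq).
  - by rewrite !updN // eq_sym.
  - by rewrite updN ?updE.
have h5 : E b c3 <-> E b (upd c' q (zeta q k)).
  apply: (hpq k j); rewrite ?updE //; do ?[exact: fs_upd|apply: fs_upd].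
  - move=> s sp sq; rewrite (updN _ _ sq) /c3 /c2.
    have [->|/eqP st] := s =P t; first by rewrite updE.
    by rewrite !updN // e.
  - by rewrite /c3 /c2 3?updN ?updE.
  - by rewrite /c3 updN ?updE.
  - by rewrite updN.
by rewrite h1 h2 h3 h5 -h4.
Qed.

Lemma exchangeable_sym b p q : exchangeable b p q -> exchangeable b q p.
Proof. by case=> [->|/swappable_sym]; [left|right]. Qed.

Lemma exchangeable_trans b p q t :
  (forall q v, exists k, sim b q v (zeta q k)) ->
  exchangeable b p q -> exchangeable b q t -> exchangeable b p t.
Proof.
move=> cover [->//|hpq] [<-|hqt]; first by right.
have [->|/eqP pq] := p =P q; first by right.
have [<-|/eqP qt] := q =P t; first by right.
have [->|/eqP pt] := p =P t; first by left.
by right; apply: swappable_trans hpq hqt.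
Qed.

Definition paint (J : S -> 'I_r.+1) (s : S) : V := zeta s (J s).

Hypothesis zeta0 : forall p, zeta p ord0 = zero.

Lemma fs_paint J : finitely_supported ord0 J -> fs (paint J).
Proof. by case=> l hl; exists l => s /hl e; rewrite /paint e. Qed.

(** Every value being similar to one in the list, [b] can be moved inside its
    class to a configuration given by a colouring. *)
Lemma painted b : fs b -> (forall p v, exists k, sim b p v (zeta p k)) ->
  exists2 J, finitely_supported ord0 J & E b (paint J).
Proof.
move=> fb cover; case: (fb) => l hl.
have /choice[J hJ] : forall s, exists k, sim b s (b s) (zeta s k) /\
    (s \notin l -> k = ord0).
  move=> s; have [sl|sl] := boolP (s \in l).
    by have [k hk] := cover s (b s); exists k.
  by exists ord0; split; rewrite // hl // zeta0; apply: sim_refl.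
have fJ : finitely_supported ord0 J by exists l => s; case: (hJ s).
exists J => //; apply/(sim_all fb (fs_paint fJ)) => [s|]; last exact: E_refl.
by case: (hJ s).
Qed.

Definition labelling b (L : eqType) (y : S -> L) : Prop :=
  forall p q, p != q -> (y p = y q <-> swappable b p q).

Local Notation R := (#|{: {ffun 'I_r.+1 -> C}}|).

(** Sites with the same colours of [cell (b p) (zeta p j)], for all [j], are
    exchangeable, so that there are at most as many exchangeability classes as
    functions from the positions to [C].  One more representative, the first
    one, is taken outside the support of [b]. *)
Lemma representatives b : fs b -> exists rho : 'I_R.+1 -> S,
  (forall p, exists i, exchangeable b p (rho i)) /\
  forall u, (forall p, b p = zero -> zeta p = u) ->
    forall p, b p = zero -> exchangeable b p (rho ord0).
Proof.
move=> fb; pose vec p := [ffun j => cell (b p) (zeta p j)].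
have vecP p q : vec p = vec q -> exchangeable b p q.
  have [->|/eqP pq] := p =P q; first by left.
  move=> /ffunP h; right; apply: swappable_cell => // j.
  by move: (h j); rewrite /vec !ffunE.
have [s0 hs0] : exists s, b s = zero.
  by have [l hl] := fb; have [s /hl] := S_infinite l; exists s.
have /choice[rep hrep] : forall v, exists s, (exists p, vec p = v) -> vec s = v.
  move=> v; have [[p hp]|h] := pselect (exists p, vec p = v); first by exists p.
  by exists s0.
exists (fun i => if unlift ord0 i is Some k then rep (enum_val k) else s0).
split.
  move=> p; exists (lift ord0 (enum_rank (vec p))); rewrite liftK enum_rankK.
  by apply: vecP; rewrite hrep //; exists p.
move=> u hu p bp; rewrite unlift_none; apply: vecP.
by apply/ffunP => j; rewrite !ffunE bp hs0 !hu.
Qed.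

(** The label of a site is the least index of a representative exchangeable
    with it; the label [ord0] goes to all the sites outside the support of [b],
    which makes the labelling finitely supported. *)
Lemma labelling_exists b u : fs b ->
  (forall p v, exists k, sim b p v (zeta p k)) ->
  (forall p, b p = zero -> zeta p = u) ->
  exists2 y : S -> 'I_R.+1, finitely_supported ord0 y & labelling b y.
Proof.
move=> fb cover hu; have [rho [hrho rho0]] := representatives fb.
have /choice[y hy] : forall p, exists i, exchangeable b p (rho i) /\
    forall k, exchangeable b p (rho k) -> i <= k.
  move=> p; have [i0 hi0] := hrho p.
  have : `[< exchangeable b p (rho i0) >] by apply/asboolP.
  case/(@arg_minnP _ i0 (fun i => `[< exchangeable b p (rho i) >])
          (@nat_of_ord _)).
  move=> i /asboolP hi hmin; exists i; split => // k hk.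
  by apply: hmin; apply/asboolP.
exists y.
  case: (fb) => l hl; exists l => s /hl bs; apply: val_inj => /=.
  by apply/eqP; rewrite -leqn0; case: (hy s) => _ /(_ _ (rho0 _ hu _ bs)).
move=> p q pq; split=> [e|h].
  have [hp _] := hy p; have [hq _] := hy q; rewrite e in hp.
  case: (exchangeable_trans cover hp (exchangeable_sym hq)) => // epq.
  by rewrite epq eqxx in pq.
apply: val_inj; apply/eqP; rewrite eqn_leq.
have [hp minp] := hy p; have [hq minq] := hy q.
have epq : exchangeable b p q by right.
rewrite minp ?minq //; last exact: exchangeable_trans cover epq hq.
exact: exchangeable_trans cover (exchangeable_sym epq) hp.
Qed.

(** A labelling is determined by the labels of the representatives. *)
Lemma labelling_bounded b (L : finType) : fs b ->
  exists F : {ffun 'I_R.+1 -> L} -> S -> L,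
    forall y, labelling b y -> exists g, y = F g.
Proof.
move=> fb; have [rho [/choice[i hi] _]] := representatives fb.
exists (fun g s => g (i s)) => y hy; exists [ffun k => y (rho k)].
apply/funext => s; rewrite ffunE; case: (hi s) => [<-//|h].
by have [<-//|/eqP/hy[_ ->]] := s =P rho (i s).
Qed.

(** * The colourings of a class up to a threshold *)

Section Determination.
Variables (L : eqType) (y : S -> L).
Local Notation fsJ := (finitely_supported (@ord0 r)).

Lemma paint_transpose b J p q : labelling b y -> fsJ J -> y p = y q ->
  E b (paint J) -> E b (paint (transpose J p q)).
Proof.
move=> hy fJ epq; have [<-|/eqP pq] := p =P q.
  by rewrite (_ : transpose J p p = J) // /transpose upd_id upd_id.
have /hy[/(_ epq) h _] := pq.
rewrite -(h (J p) (J q) (paint J)) /paint /transpose //.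
- exact: fs_paint.
- by apply: fs_paint; do 2!apply: fs_upd.
- by move=> s sp sq; rewrite !updN.
- by rewrite updN ?updE.
- by rewrite updE.
Qed.

(** With [J] equal to [j] on [l] and to [i] on [l'], this interchanges the
    colours of the sites of [l] with those of [l']. *)
Definition exchange T (J : S -> T) (i j : T) (l l' : seq S) (s : S) : T :=
  if s \in l then i else if s \in l' then j else J s.

Lemma fs_exchange T d (J : S -> T) i j l l' :
  finitely_supported d J -> finitely_supported d (exchange J i j l l').
Proof.
case=> k hk; exists (l ++ l' ++ k) => s.
by rewrite !mem_cat !negb_or /exchange => /and3P[/negPf-> /negPf-> /hk].
Qed.

Lemma paint_exchange b J n i j l l' : labelling b y -> fsJ J ->
  i != j -> uniq l -> uniq l' -> size l = size l' ->
  (forall s, s \in l -> y s = n /\ J s = j) ->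
  (forall s, s \in l' -> y s = n /\ J s = i) ->
  E b (paint J) -> E b (paint (exchange J i j l l')).
Proof.
move=> hy fJ ij; elim: l l' => [|q l IH] [|t l'] //=.
move=> /andP[ql ul] /andP[tl' ul'] [sz] hl hl' EJ.
have [yq Jq] := hl q (mem_head _ _); have [yt Jt] := hl' t (mem_head _ _).
have hl2 s : s \in l -> y s = n /\ J s = j.
  by move=> sl; apply: hl; rewrite inE sl orbT.
have hl2' s : s \in l' -> y s = n /\ J s = i.
  by move=> sl; apply: hl'; rewrite inE sl orbT.
have ql' : q \notin l' by apply: contra ij => /hl2'[_ <-]; rewrite Jq.
have tl : t \notin l by apply: contra ij => /hl2[_ <-]; rewrite Jt.
have qt : q != t by apply: contra ij => /eqP qt; rewrite -Jq -Jt qt.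
rewrite (_ : exchange _ _ _ _ _ = transpose (exchange J i j l l') q t).
  apply: paint_transpose => //; first exact: fs_exchange.
    by rewrite yq yt.
  exact: IH.
apply/funext => s; rewrite /transpose /upd /exchange !inE.
case: (s =P t) => [->|/eqP st]; last first.
  case: (s =P q) => [->|//] /=.
  by rewrite (negPf tl) (negPf tl') Jt.
rewrite eq_sym (negPf qt) (negPf tl) /=.
by rewrite (negPf ql) (negPf ql') Jq.
Qed.

Lemma pigeonhole (D : finType) (f : S -> D) l k : uniq l -> #|D| * k < size l ->
  exists l', [/\ uniq l', size l' = k.+1, {subset l' <= l} &
    forall s t, s \in l' -> t \in l' -> f s = f t].
Proof.
move=> ul hl; have [d hd] : exists d, k < count_mem d (map f l).
  apply: contrapT => /forallNP h; move: hl.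
  rewrite ltnNge -(size_map f) size_count_mem -sum_nat_const => /negP; apply.
  by apply: leq_sum => d _; rewrite leqNgt; apply/negP/h.
rewrite count_mem_map in hd.
exists (take k.+1 [seq s <- l | f s == d]); split.
- by rewrite take_uniq // filter_uniq.
- by rewrite size_takel.
- by move=> s /mem_take; rewrite mem_filter => /andP[].
- move=> s t /mem_take; rewrite mem_filter => /andP[/eqP-> _].
  by move=> /mem_take; rewrite mem_filter => /andP[/eqP-> _].
Qed.

(** Enough for [2 * K + 1] sites, out of [threshold] many, to have the same
    colour under a colouring by [C * C]. *)
Definition threshold := (#|{: C * C}| * (K + K)).+1.

(** By pigeonhole, some [2 * K + 1] sites of colour [j] have the same
    [cell (zeta s j) (zeta s j)] and the same [cell (zeta s j) (zeta s i)].
    Let [q] be one of them, [Qa] be [K] others and [Qb] the last [K].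
    Interchanging the colours of [Qb] and of [K] sites of colour [i] gives
    [J3], still in the class.  Compared with [J], both the first cell (on [Qa])
    and the second one (on [Qb]) then occur [K] times outside [q]; so changing
    [q] from [j] to [i] goes unnoticed and stays in the class.  It remains to
    undo the interchange and to bring the change from [q] to [p]. *)
Lemma recolour b J n i j p l l' : fs b -> labelling b y -> fsJ J ->
  i != j -> uniq l -> uniq l' -> threshold <= size l -> K <= size l' ->
  (forall s, s \in l -> y s = n /\ J s = j) ->
  (forall s, s \in l' -> y s = n /\ J s = i) ->
  y p = n -> J p = j -> E b (paint J) -> E b (paint (upd J p i)).
Proof.
move=> fb hy fJ ij ul ul' szl szl' hl hl' yp Jp EJ.
have := pigeonhole
  (fun s => (cell (zeta s j) (zeta s j), cell (zeta s j) (zeta s i))) ul szl.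
case=> -[|q Q] [] // /andP[qQ uQ] [szQ] subQ eQ.
pose Qa := take K Q; pose Qb := drop K Q; pose T := take K l'.
have szQa : size Qa = K by rewrite size_takel // szQ leq_addr.
have szQb : size Qb = K by rewrite size_drop szQ addnK.
have szT : size T = K by rewrite size_takel.
have uQb : uniq Qb by rewrite drop_uniq.
have uT : uniq T by rewrite take_uniq.
have hQ s : s \in q :: Q -> y s = n /\ J s = j by move/subQ/hl.
have hQa s : s \in Qa -> s \in q :: Q by move/mem_take => h; rewrite inE h orbT.
have hQb s : s \in Qb -> s \in q :: Q by move/mem_drop => h; rewrite inE h orbT.
have hT s : s \in T -> y s = n /\ J s = i by move/mem_take/hl'.
have notT s : s \in q :: Q -> s \notin T.
  by move=> /hQ[_ Js]; apply: contra ij => /hT[_ <-]; rewrite Js.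
have disj s : s \in Qa -> s \notin Qb.
  have : uniq (Qa ++ Qb) by rewrite cat_take_drop.
  rewrite cat_uniq => /and3P[_ /hasPn h _] sa.
  by apply/negP => /h; rewrite /= sa.
have qQa : q \notin Qa by apply: contra qQ => /mem_take.
have qQb : q \notin Qb by apply: contra qQ => /mem_drop.
have qin : q \in q :: Q := mem_head _ _.
pose J3 := exchange J i j Qb T.
have fJ3 : fsJ J3 by apply: fs_exchange.
have E3 : E b (paint J3).
  apply: paint_exchange hy fJ ij uQb uT _ _ hT EJ; first by rewrite szQb szT.
  by move=> s /hQb/hQ.
pose J4 := upd J3 q i.
have J3a s : s \in Qa -> J3 s = j.
  move=> sa; rewrite /J3 /exchange (negPf (disj s sa)).
  rewrite (negPf (notT s (hQa s sa))).
  by case: (hQ s (hQa s sa)).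
have J3b s : s \in Qb -> J3 s = i by rewrite /J3 /exchange => ->.
have J3q : J3 q = j.
  rewrite /J3 /exchange (negPf qQb) (negPf (notT q qin)).
  by case: (hQ q qin).
have fJ4 : fsJ J4 by apply: fs_upd.
have Jq : J q = j by case: (hQ q qin).
have E4 : E b (paint J4).
  have E03 : E (paint J) (paint J3) by apply: E_trans E3; apply: E_sym.
  apply: E_trans EJ _; apply: E_local E03; do ?exact: fs_paint.
  rewrite (_ : (fun s => cell _ (paint J4 s)) =
    upd (fun s => cell (paint J s) (paint J3 s)) q
      (cell (zeta q j) (zeta q i))).
    apply: (@similar_upd _ _ _ _ _ _ Qa Qb); rewrite ?szQa ?szQb ?take_uniq //.
      move=> s sa; split; first by apply: contraNneq qQa => <-.
      rewrite /paint J3a // J3q Jq; case: (hQ s (hQa s sa)) => _ ->.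
      by case: (eQ s q (hQa s sa) qin).
    move=> s sb; split; first by apply: contraNneq qQb => <-.
    rewrite /paint J3b //; case: (hQ s (hQb s sb)) => _ ->.
    by case: (eQ s q (hQb s sb) qin).
  apply/funext => s; rewrite /paint /J4 /upd.
  by case: eqP => // ->; rewrite Jq.
have E5 : E b (paint (upd J q i)).
  have hT4 s : s \in T -> y s = n /\ J4 s = j.
    move=> sT; case: (hT s sT) => ys _; split=> //.
    have sq : s != q by apply: contraTneq sT => ->; apply: notT.
    rewrite /J4 updN // /J3 /exchange sT (negPf (_ : s \notin Qb)) //.
    by apply: contraL sT => /hQb/notT.
  have hQ4 s : s \in Qb -> y s = n /\ J4 s = i.
    move=> sb; case: (hQ s (hQb s sb)) => ys _; split=> //.
    by rewrite /J4 updN ?J3b //; apply: contraNneq qQb => <-.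
  have := paint_exchange hy fJ4 ij uT uQb (etrans szT (esym szQb)) hT4 hQ4 E4.
  rewrite (_ : exchange _ _ _ _ _ = upd J q i) //.
  apply/funext => s; rewrite /exchange /J4 /upd /J3 /exchange.
  case sT: (s \in T).
    case: (hT s sT) => _ ->; case: eqP => // sq.
  case sb: (s \in Qb) => //.
  case: (hQ s (hQb s sb)) => _ ->; case: eqP => // sq.
  by rewrite sq (negPf qQb) in sb.
have [->//|/eqP pq] := p =P q.
have [yq _] := hQ q qin.
rewrite (_ : upd J p i = transpose (upd J q i) p q).
  by apply: paint_transpose; rewrite ?yp //; apply: fs_upd.
apply/funext => s; rewrite /transpose /upd eqxx (negPf pq).
have [->|_] := s =P q; first by rewrite eq_sym (negPf pq) Jq Jp.
by case: eqP.
Qed.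

(** If [n < k] sites were all those of colour [d] under [f], then [n + 1] sites
    would have this colour under [g]. *)
Lemma similar_monochromatic (D : eqType) k (f g : S -> D) d p : similar k f g ->
  (forall s, f s = d -> g s = d) -> g p = d -> f p != d ->
  exists l, [/\ uniq l, size l = k & forall s, s \in l -> f s = d].
Proof.
move=> h fg gp fp; apply/realizes_nseq.
suff aux n : n <= k -> realizes f (nseq n d) by apply: aux.
elim: n => [_|n IH nk]; first by exists [::].
apply/(h (nseq n.+1 d)); first by rewrite size_nseq.
have /realizes_nseq[l [ul sl hl]] := IH (ltnW nk).
apply/realizes_nseq; exists (p :: l); rewrite /= sl ul andbT; split=> //.
  by apply: contra fp => /hl ->.
by move=> s; rewrite inE => /orP[/eqP->//|/hl/fg].
Qed.

(** By induction on the number of sites where [J1] and [J2] differ.  At such a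
    site [p], one wants to give to [p] the colour [J2 p] in [J1], or [J1 p] in
    [J2].  If an exchangeable [q] has the colour that is wanted, and has another
    one in the other colouring, then the colours of [p] and [q] can be
    interchanged.  Otherwise, among the sites exchangeable with [p], those of
    colour [J2 p] in [J1] form a proper subset of those of this colour in [J2],
    and the other way round for the colour [J1 p].  As the numbers of such sites
    agree up to the threshold, both colours occur that many times in [J1], and
    [p] can be recoloured. *)
Lemma E_of_similar b1 b2 J1 J2 : fs b1 -> fs b2 ->
  labelling b1 y -> labelling b2 y -> fsJ J1 -> fsJ J2 ->
  E b1 (paint J1) -> E b2 (paint J2) ->
  similar threshold (fun s => (y s, J1 s)) (fun s => (y s, J2 s)) ->
  E b1 b2.
Proof.
move=> fb1 fb2 hy1 hy2 fJ1 fJ2; have [l _ hl] := fs_diff fJ1 fJ2.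
have [n] := ubnP (count (fun s => J1 s != J2 s) l).
elim: n J1 J2 fJ1 fJ2 hl => // n IH J1 J2 fJ1 fJ2 hl.
rewrite ltnS => len E1 E2 h.
have step J1' J2' p : fsJ J1' -> fsJ J2' ->
    (forall s, J1' s != J2' s -> J1 s != J2 s) -> J1 p != J2 p ->
    J1' p = J2' p -> E b1 (paint J1') -> E b2 (paint J2') ->
    similar threshold (fun s => (y s, J1' s)) (fun s => (y s, J2' s)) ->
    E b1 b2.
  move=> fJ1' fJ2' mono Jp J'p; apply: IH => //.
    by move=> s sl; apply/eqP/negPn/negP => /mono; rewrite hl ?eqxx.
  apply: leq_trans len; have pl : p \in l by apply: contraNT Jp => /hl->.
  elim: l pl {hl} => //= s l IH'; rewrite inE => /orP[/eqP<-|/IH' lt].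
    by rewrite Jp J'p eqxx add0n add1n ltnS; apply: sub_count.
  rewrite -addnS leq_add //.
  by case: (J1' s =P J2' s) => [//|/eqP /mono->].
have [eJ|] := pselect (forall p, J1 p = J2 p).
  apply: E_trans E1 _; apply: E_sym; apply: E_trans E2 _.
  by rewrite (funext eJ).
move=> /existsNP[p /eqP Jp].
have pairs J p' q : y p' = y q -> (fun s => (y s, transpose J p' q s)) =
    transpose (fun s => (y s, J s)) p' q.
  move=> e; apply/funext => s; rewrite /transpose /upd.
  by case: eqP => [->|_]; [rewrite e|case: eqP => // ->; rewrite e].
have [[q [yq Jq1 Jq2]]|no1] :=
    pselect (exists q, [/\ y p = y q, J1 q = J2 p & J2 q != J2 p]).
  apply: (step (transpose J1 p q) J2 p) => //.
  - exact: fs_transpose.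
  - move=> s; rewrite /transpose /upd.
    case: (s =P q) => [->|_]; first by move=> _; rewrite Jq1 eq_sym.
    by case: (s =P p) => [->|//]; rewrite Jq1 eqxx.
  - rewrite /transpose /upd eqxx; case: eqP => [pq|//].
    by rewrite -pq eqxx in Jq2.
  - exact: paint_transpose.
  - rewrite pairs //; apply: similar_trans h.
    exact/similar_sym/similar_transpose.
have [[q [yq Jq1 Jq2]]|no2] :=
    pselect (exists q, [/\ y p = y q, J2 q = J1 p & J1 q != J1 p]).
  apply: (step J1 (transpose J2 p q) p) => //.
  - exact: fs_transpose.
  - move=> s; rewrite /transpose /upd.
    case: (s =P q) => [->|_]; first by rewrite Jq1.
    by case: (s =P p) => [->|//]; rewrite Jq1 eqxx.
  - rewrite /transpose /upd eqxx; case: eqP => [pq|//].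
    by rewrite -pq eqxx in Jq2.
  - exact: paint_transpose.
  - by rewrite pairs //; apply: similar_trans h _; apply: similar_transpose.
have [|||A [uA sA hA]] :=
  @similar_monochromatic _ _ _ _ (y p, J1 p) p (similar_sym h).
- move=> s [ys Js]; rewrite ys; congr (_, _); apply/eqP/negPn/negP => ne.
  by apply: no2; exists s.
- by [].
- by apply: contra Jp => /eqP[->].
have [|||B [uB sB hB]] := @similar_monochromatic _ _ _ _ (y p, J2 p) p h.
- move=> s [ys Js]; rewrite ys; congr (_, _); apply/eqP/negPn/negP => ne.
  by apply: no1; exists s.
- by [].
- by apply: contra Jp => /eqP[->].
have hA' s : s \in A -> y s = y p /\ J1 s = J1 p.
  move=> /hA[ys Js]; split=> //; apply/eqP/negPn/negP => ne.
  by apply: no2; exists s.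
have hB' s : s \in B -> y s = y p /\ J1 s = J2 p by move=> /hB[].
have KT : K <= threshold.
  rewrite /threshold; apply: leqW; apply: leq_trans (leq_addr K K) _.
  rewrite leq_pmull //; apply/card_gt0P.
  have [s _] := S_infinite [::].
  by exists (cell (b1 s) (b1 s), cell (b1 s) (b1 s)).
apply: (step (upd J1 p (J2 p)) J2 p) => //.
- exact: fs_upd.
- by move=> s; rewrite /upd; case: (s =P p) => [->|//]; rewrite eqxx.
- by rewrite updE.
- apply: (recolour fb1 hy1 fJ1 _ uA uB _ _ hA' hB') => //.
  + by rewrite eq_sym.
  + by rewrite sA.
  + by rewrite sB.
apply: similar_trans h; apply: similar_sym.
rewrite (_ : (fun s => (y s, upd _ _ _ _)) =
  upd (fun s => (y s, J1 s)) p (y p, J2 p)).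
  apply: (@similar_upd _ _ _ _ _ _ A B); rewrite ?sA ?sB //.
    move=> s sA'; case: (hA' s sA') => -> ->; split=> //.
    apply: contraNneq Jp => <-; case: (hA s sA') => _ ->.
    by case: (hA' s sA') => _ ->.
  move=> s sB'; case: (hB' s sB') => ys Js; rewrite ys Js; split=> //.
  by apply: contraNneq Jp => e; rewrite -{1}e Js.
by apply/funext => s; rewrite /upd; case: eqP => // ->.
Qed.

End Determination.

End Colours.

End Classes.

(** * Relations definable uniformly in all structures *)

Fixpoint term_rename (V W : Type) (g : V -> W) (t : term V) : term W :=
  match t with
  | Var v => Var (g v)
  | One => One
  | Mul t1 t2 => Mul (term_rename g t1) (term_rename g t2)
  end.

Fixpoint rename (V : Type) (f : formula V) :
    forall W : Type, (V -> W) -> formula W :=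
  match f with
  | Eq t1 t2 => fun W g => Eq (term_rename g t1) (term_rename g t2)
  | Not f1 => fun W g => Not (rename f1 g)
  | And f1 f2 => fun W g => And (rename f1 g) (rename f2 g)
  | Ex f1 => fun W g => Ex (rename f1 (omap g))
  end.

Lemma eval_rename (M : structure) V W (g : V -> W) (e : W -> M) t :
  eval e (term_rename g t) = eval (fun v => e (g v)) t.
Proof. by elim: t => //= t1 -> t2 ->. Qed.

Lemma sat_rename (M : structure) V (f : formula V) W (g : V -> W) (e : W -> M) :
  sat e (rename f g) <-> sat (fun v => e (g v)) f.
Proof.
elim: f W g e => {V} [V t1 t2|V f IH|V f1 IH1 f2 IH2|V f IH] W g e /=.
- by rewrite !eval_rename.
- by rewrite IH.
- by rewrite IH1 IH2.
- have aux x : (fun v => scons x e (omap g v)) = scons x (fun v => e (g v)).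
    by apply/funext => -[].
  by split=> -[x hx]; exists x; move: hx; rewrite IH aux.
Qed.

(** The value [v0] is the image of the elements of [W] that a quantifier binds,
    where [W] indexes the variables of the formula under the quantifier. *)
Lemma formula_support V (v0 : V) (f : formula V) :
  exists (W : finType) (g : W -> V) (f' : formula W),
    forall (M : structure) (e : V -> M), sat e f <-> sat (fun w => e (g w)) f'.
Proof.
pose glue U W1 W2 (g1 : W1 -> U) (g2 : W2 -> U) (w : W1 + W2) : U :=
  match w with inl w => g1 w | inr w => g2 w end.
have tsupp U (t : term U) : exists (W : finType) (g : W -> U) (t' : term W),
    forall (M : structure) (e : U -> M), eval e t = eval (fun w => e (g w)) t'.
  elim: t => [u||t1 [W1 [g1 [t1' h1]]] t2 [W2 [g2 [t2' h2]]]].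
  - by exists unit, (fun=> u), (Var tt).
  - by exists void, (fun v : void => match v with end), One.
  - exists (W1 + W2)%type, (glue _ _ _ g1 g2).
    exists (Mul (term_rename inl t1') (term_rename inr t2')) => M e /=.
    by rewrite !eval_rename h1 h2.
elim: f v0 => {V} [V t1 t2|V f IH|V f1 IH1 f2 IH2|V f IH] v0.
- have [W1 [g1 [t1' h1]]] := tsupp _ t1; have [W2 [g2 [t2' h2]]] := tsupp _ t2.
  exists (W1 + W2)%type, (glue _ _ _ g1 g2).
  exists (Eq (term_rename inl t1') (term_rename inr t2')) => M e /=.
  by rewrite !eval_rename h1 h2.
- have [W [g [f' h]]] := IH v0; exists W, g, (Not f') => M e /=.
  by rewrite h.
- have [W1 [g1 [t1' h1]]] := IH1 v0; have [W2 [g2 [t2' h2]]] := IH2 v0.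
  exists (W1 + W2)%type, (glue _ _ _ g1 g2).
  exists (And (rename t1' inl) (rename t2' inr)) => M e /=.
  by rewrite !sat_rename h1 h2.
- have [W [g [f' h]]] := IH (Some v0).
  exists W, (fun w => odflt v0 (g w)).
  exists (Ex (rename f' (fun w => if g w is Some _ then Some w else None))).
  move=> M e /=.
  have aux x : (fun w => scons x e (g w)) =
      (fun w => scons x (fun w => e (odflt v0 (g w)))
                  (if g w is Some _ then Some w else None)).
    by apply/funext => w; case ew: (g w) => [v|] //=; rewrite ew.
  by split=> -[x hx]; exists x; move: hx; rewrite sat_rename h -aux.
Qed.

(** The relation is given in all structures at once: one formula serves them
    all, and this is what lets a property of the standard model be transferred
    to the other models of its theory.  Relations are written with the
    quantifiers and connectives of the ambient logic, and the closure lemmas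
    below find the formula. *)
Definition definable_relation V
    (R : forall M : structure, (V -> M) -> Prop) : Prop :=
  exists f : formula V, forall M e, sat e f <-> R M e.

Section Closure.
Implicit Types V W : Type.

Lemma def_sat V W (f : formula W) (g : W -> V) :
  definable_relation (fun M (e : V -> M) => sat (fun w => e (g w)) f).
Proof. by exists (rename f g) => M e; rewrite sat_rename. Qed.

Lemma def_rename V W (g : W -> V) (R : forall M : structure, (W -> M) -> Prop) :
  definable_relation R ->
  definable_relation (fun M (e : V -> M) => R M (fun w => e (g w))).
Proof. by case=> f h; exists (rename f g) => M e; rewrite sat_rename h. Qed.

Lemma def_const V (P : Prop) :
  definable_relation (fun M (_ : V -> M) => P).
Proof.
have [p|np] := pselect P; first by exists (Eq One One).
by exists (Not (Eq One One)) => M e /=; split=> // h; case: h.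
Qed.

Section Connectives.
Variables (V : Type) (R R' : forall M : structure, (V -> M) -> Prop).

Lemma def_not : definable_relation R ->
  definable_relation (fun M (e : V -> M) => ~ @R M e).
Proof. by case=> f h; exists (Not f) => M e /=; rewrite h. Qed.

Lemma def_and : definable_relation R -> definable_relation R' ->
  definable_relation (fun M (e : V -> M) => @R M e /\ @R' M e).
Proof. by case=> f h [g h']; exists (And f g) => M e /=; rewrite h h'. Qed.

Lemma def_imp : definable_relation R -> definable_relation R' ->
  definable_relation (fun M (e : V -> M) => @R M e -> @R' M e).
Proof.
case=> f h [g h']; exists (Not (And f (Not g))) => M e /=; rewrite h h'.
by split=> [H r|H [/H]] //; apply: contrapT => r'; apply: H.
Qed.

Lemma def_or : definable_relation R -> definable_relation R' ->
  definable_relation (fun M (e : V -> M) => @R M e \/ @R' M e).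
Proof.
case=> f h [g h']; exists (Not (And (Not f) (Not g))) => M e /=; rewrite h h'.
by rewrite not_andP !not_notE.
Qed.

Lemma def_iff : definable_relation R -> definable_relation R' ->
  definable_relation (fun M (e : V -> M) => @R M e <-> @R' M e).
Proof.
case=> f h [g h'].
exists (And (Not (And f (Not g))) (Not (And g (Not f)))) => M e /=.
rewrite h h' /iff.
by split=> -[H1 H2]; split=> r;
  [apply: contrapT => r'; apply: H1|apply: contrapT => r'; apply: H2
  |case: r => /H1|case: r => /H2].
Qed.

End Connectives.

Lemma def_ex V (Q : forall M : structure, (V -> M) -> M -> Prop) :
  definable_relation (fun M (e : option V -> M) =>
    Q M (fun v => e (Some v)) (e None)) ->
  definable_relation (fun M (e : V -> M) => exists x : M, Q M e x).
Proof.
case=> f h; exists (Ex f) => M e /=.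
by split=> -[x hx]; exists x; move: hx; rewrite h.
Qed.

Lemma def_ext V (R R' : forall M : structure, (V -> M) -> Prop) :
  (forall M e, R M e <-> R' M e) ->
  definable_relation R -> definable_relation R'.
Proof. by move=> e [f h]; exists f => M x; rewrite h e. Qed.

Lemma def_all V (Q : forall M : structure, (V -> M) -> M -> Prop) :
  definable_relation (fun M (e : option V -> M) =>
    Q M (fun v => e (Some v)) (e None)) ->
  definable_relation (fun M (e : V -> M) => forall x : M, Q M e x).
Proof.
move=> h; apply: (@def_ext _ (fun M e => ~ exists x, ~ Q M e x)).
  move=> M e; split=> [H x|H [x /(_ (H x))//]].
  by apply: contrapT => nQ; apply: H; exists x.
by apply/def_not/(@def_ex _ (fun M e x => ~ Q M e x))/def_not.
Qed.

Lemma def_ex_tuple V (W : finType)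
    (Q : forall M : structure, (V -> M) -> (W -> M) -> Prop) :
  definable_relation (fun M (e : V + W -> M) =>
    Q M (fun v => e (inl v)) (fun w => e (inr w))) ->
  definable_relation (fun M (e : V -> M) => exists x : W -> M, Q M e x).
Proof.
suff ordinals n V' (P : forall M : structure, (V' -> M) -> ('I_n -> M) -> Prop) :
    definable_relation (fun M (e : V' + 'I_n -> M) =>
      P M (fun v => e (inl v)) (fun w => e (inr w))) ->
    definable_relation (fun M (e : V' -> M) => exists x, P M e x).
  move=> h; apply: (@def_ext _ (fun M e =>
      exists x : 'I_#|W| -> M, Q M e (fun w => x (enum_rank w)))).
    move=> M e; split=> -[x hx]; first by exists (fun w => x (enum_rank w)).
    exists (fun i => x (enum_val i)).
    by rewrite (_ : (fun w => _) = x) //; apply/funext => w; rewrite enum_rankK.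
  apply: ordinals.
  exact: (def_rename (fun v : V + W => match v return V + 'I_#|W| with
    inl v => inl v | inr w => inr (enum_rank w) end) h).
elim: n V' P => [|n IH] U P h.
  pose g (v : U + 'I_0) : U := match v with
    inl v => v | inr i => False_rect _ (notF (ltn_ord i)) end.
  apply: def_ext (def_rename g h) => M e /=.
  have only (x x' : 'I_0 -> M) : x = x' by apply/funext => -[].
  split=> [hx|[x hx]]; first by exists (fun i => e (g (inr i))).
  by rewrite (only (fun i => e (g (inr i))) x).
pose fcons (M : structure) (x : M) (x' : 'I_n -> M) (i : 'I_n.+1) : M :=
  if unlift ord0 i is Some j then x' j else x.
apply: (@def_ext _ (fun M e => exists x : M, exists x', P M e (fcons M x x'))).
  move=> M e; split=> [[x [x' hx]]|[x hx]]; first by exists (fcons M x x').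
  exists (x ord0), (fun j => x (lift ord0 j)).
  rewrite (_ : fcons _ _ _ = x) //; apply/funext => i.
  by rewrite /fcons; case: unliftP => [j ->|->].
apply: (@def_ex _ (fun M e x => exists x', P M e (fcons M x x'))).
apply: (IH _ (fun M e x' => P M (fun v => e (Some v)) (fcons M (e None) x'))).
pose g (v : U + 'I_n.+1) : option U + 'I_n := match v with
  | inl v => inl (Some v)
  | inr i => if unlift ord0 i is Some j then inr j else inl None end.
apply: def_ext (def_rename g h) => M e /=.
rewrite (_ : (fun i => e (g (inr i))) =
  fcons M (e (inl None)) (fun j => e (inr j))) //.
by apply/funext => i; rewrite /fcons /g; case: unlift.
Qed.

Lemma def_all_tuple V (W : finType)
    (Q : forall M : structure, (V -> M) -> (W -> M) -> Prop) :
  definable_relation (fun M (e : V + W -> M) =>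
    Q M (fun v => e (inl v)) (fun w => e (inr w))) ->
  definable_relation (fun M (e : V -> M) => forall x : W -> M, Q M e x).
Proof.
move=> h; apply: (@def_ext _ (fun M e => ~ exists x, ~ Q M e x)).
  move=> M e; split=> [H x|H [x /(_ (H x))//]].
  by apply: contrapT => nQ; apply: H; exists x.
by apply/def_not/(@def_ex_tuple _ _ (fun M e x => ~ Q M e x))/def_not.
Qed.

Lemma def_forall V (I : finType)
    (Q : I -> forall M : structure, (V -> M) -> Prop) :
  (forall i, definable_relation (Q i)) ->
  definable_relation (fun M (e : V -> M) => forall i, Q i M e).
Proof.
move=> h; suff [f hf] : definable_relation (fun M (e : V -> M) =>
    forall i, i \in enum I -> Q i M e).
  by exists f => M e; rewrite hf; split=> H i; [apply: H; rewrite mem_enum|].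
elim: (enum I) => [|i s IH]; first by apply: def_ext (def_const V True).
apply: def_ext (def_and (h i) IH) => M e; split=> [[H1 H2] j|H].
  by rewrite inE => /orP[/eqP->//|/H2].
by split=> [|j js]; apply: H; rewrite inE ?eqxx ?js ?orbT.
Qed.

Lemma def_exists V (I : finType)
    (Q : I -> forall M : structure, (V -> M) -> Prop) :
  (forall i, definable_relation (Q i)) ->
  definable_relation (fun M (e : V -> M) => exists i, Q i M e).
Proof.
move=> h; apply: (@def_ext _ (fun M e => ~ forall i, ~ Q i M e)).
  move=> M e; split=> [H|[i Qi] /(_ i)//].
  by apply: contrapT => nQ; apply: H => i Qi; apply: nQ; exists i.
by apply/def_not/(@def_forall _ _ (fun i M e => ~ Q i M e)) => i; apply: def_not.
Qed.

Lemma def_mul V (x y z : V) :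
  definable_relation (fun M (e : V -> M) => smul (e x) (e y) = e z).
Proof. by exists (Eq (Mul (Var x) (Var y)) (Var z)). Qed.

Lemma def_one V (x : V) :
  definable_relation (fun M (e : V -> M) => e x = sone M).
Proof. by exists (Eq (Var x) One). Qed.

Lemma def_eq V (x y : V) :
  definable_relation (fun M (e : V -> M) => e x = e y).
Proof. by exists (Eq (Var x) (Var y)). Qed.

Lemma def_power V (x y : V) n :
  definable_relation (fun M (e : V -> M) => e y = iter n (smul (e x)) (sone M)).
Proof.
exists (Eq (Var y) (iter n (Mul (Var x)) One)) => M e /=.
by have -> : eval e (iter n (Mul (Var x)) One) = iter n (smul (e x)) (sone M);
  first by elim: n => //= n ->.
Qed.

End Closure.

Ltac definability_step := first
  [ apply: def_mul | apply: def_one | apply: def_eq | apply: def_power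
  | apply: def_sat | apply: def_const
  | apply: def_iff | apply: def_and | apply: def_or | apply: def_imp
  | apply: def_not
  | apply: def_all | apply: def_ex | apply: def_all_tuple | apply: def_ex_tuple
  | apply: def_forall => ? | apply: def_exists => ? ].

(** * Codes *)

Definition join T A B (x : A -> T) (y : B -> T) (v : A + B) : T :=
  match v with inl a => x a | inr b => y b end.

(** The notions that determine a class of configurations, written in the
    language of monoids.  Equality at a prime [p] is to be read as: the same
    [p]-adic valuation; the sites are the primes, and [value_at i p x] says that
    the valuation is [i].  The sets considered are those defined by [phi] with
    [m] parameters; [r.+1], [R.+1] and [k] are the length of the lists of
    values, the number of labels and the threshold. *)
Section Relations.
Variables (n m r R k : nat) (phi : formula ('I_n + 'I_m)).
Variable u : 'I_r.+1 -> 'I_m -> nat.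
Variable nu : {ffun k.-bseq ('I_R.+1 * 'I_r.+1) -> bool}.

Section InStructure.
Variable M : structure.
Implicit Types x y p q J : M.
Implicit Types b c : 'I_m -> M.

Definition divides x y := exists z, smul x z = y.

Definition prime_element p :=
  ~ p = sone M /\ forall x y, smul x y = p -> x = sone M \/ y = sone M.

Definition prime_power p q :=
  forall d, prime_element d -> divides d q -> d = p.

Definition le_at p x y :=
  forall q, prime_power p q -> divides q x -> divides q y.

Definition eq_at p x y := le_at p x y /\ le_at p y x.

Definition value_at i p x :=
  exists y, y = iter i (smul p) (sone M) /\ eq_at p x y.

Definition eqs_at p b c := forall i, eq_at p (b i) (c i).

Definition lex_at p b c :=
  exists i : 'I_m, ~ le_at p (c i) (b i) /\
    forall j : 'I_m, j < i -> eq_at p (b j) (c j).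

Definition same_set b c :=
  forall x : 'I_n -> M, sat (join x b) phi <-> sat (join x c) phi.

Definition sim_at b p v w := forall c c',
  (forall q, prime_element q -> ~ q = p -> eqs_at q c c') ->
  eqs_at p c v -> eqs_at p c' w -> (same_set b c <-> same_set b c').

Definition greedy_at b p (g : 'I_r.+1 * 'I_m -> M) := forall j : 'I_r.+1,
  ((forall i : 'I_r.+1, i < j ->
      ~ sim_at b p (fun l => g (j, l)) (fun l => g (i, l))) /\
   (forall v, lex_at p v (fun l => g (j, l)) ->
      exists i : 'I_r.+1, i < j /\ sim_at b p v (fun l => g (i, l)))) \/
  ((forall v, exists i : 'I_r.+1, i < j /\ sim_at b p v (fun l => g (i, l))) /\
   forall l, value_at 0 p (g (j, l))).

(** At all but finitely many primes the greedy lists are the constant list [u],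
    which need not vanish, whereas an element has valuation zero at all but
    finitely many primes.  So the lists are stored after an exchange of the
    values [0] and [a], for [a] the corresponding entry of [u]. *)
Definition twisted a p x y :=
  (value_at 0 p x /\ value_at a p y) \/ (value_at a p x /\ value_at 0 p y) \/
  (~ value_at 0 p x /\ ~ value_at a p x /\ eq_at p x y).

Implicit Type w : option ('I_r.+1 * 'I_m) -> M.

(** In a code, the entries [Some (i, l)] store the lists of values, and the
    entry [None] the labelling. *)
Definition coloured w i p c :=
  forall l, twisted (u i l) p (w (Some (i, l))) (c l).

Definition swappable_at b w p q := forall (i j : 'I_r.+1) c c',
  (forall t, prime_element t -> ~ t = p -> ~ t = q -> eqs_at t c c') ->
  coloured w i p c -> coloured w j q c ->
  coloured w j p c' -> coloured w i q c' ->
  (same_set b c <-> same_set b c').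

Definition realized_in y J (t : seq ('I_R.+1 * 'I_r.+1)) :=
  exists f : 'I_(size t) -> M,
    (forall i, prime_element (f i)) /\
    (forall i j, i != j -> ~ f i = f j) /\
    forall i : 'I_(size t), value_at (nth (ord0, ord0) t i).1 (f i) y /\
              value_at (nth (ord0, ord0) t i).2 (f i) J.

(** The colouring [J] and the configuration [c] that it gives are not part of
    the code: of them it only keeps [nu], which says what [J] looks like up to
    the threshold.  Both [u] and [nu] are fixed in the formula; finitely many
    choices of them serve all the [b] ([code_exists]). *)
Definition coded b w :=
  (forall p, prime_element p -> exists g : 'I_r.+1 * 'I_m -> M,
     (forall i, coloured w i p (fun l => g (i, l))) /\ greedy_at b p g) /\
  (forall p, prime_element p -> exists l : 'I_R.+1, value_at l p (w None)) /\
  (forall p q, prime_element p -> prime_element q -> ~ p = q ->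
     ((exists l : 'I_R.+1, value_at l p (w None) /\ value_at l q (w None)) <->
      swappable_at b w p q)) /\
  (exists J, exists c : 'I_m -> M,
     (forall p, prime_element p -> exists i : 'I_r.+1,
        value_at i p J /\ coloured w i p c) /\
     same_set b c /\
     forall t, nu t <-> realized_in (w None) J t).

End InStructure.

End Relations.

Section Definability.
Variables (V : Type) (n m : nat) (phi : formula ('I_n + 'I_m)).

Lemma def_same_set (b c : 'I_m -> V) : definable_relation (fun M (e : V -> M) =>
  same_set phi (fun i => e (b i)) (fun i => e (c i))).
Proof.
rewrite /same_set; apply: def_all_tuple; cbv beta.
have aux (d : 'I_m -> V) : definable_relation (fun M (e : V + 'I_n -> M) =>
    sat (join (fun i => e (inr i)) (fun i => e (inl (d i)))) phi).
  apply: def_ext (def_sat phi (join inr (fun i => inl (d i)))) => M e.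
  by rewrite (_ : join _ _ = fun w => e (join inr (fun i => inl (d i)) w)) //;
     apply/funext => -[].
by apply: def_iff; apply: aux.
Qed.

End Definability.

Section CodeDefinability.
Variables (V : Type) (n m r R k : nat) (phi : formula ('I_n + 'I_m)).
Variable u : 'I_r.+1 -> 'I_m -> nat.
Variable nu : {ffun k.-bseq ('I_R.+1 * 'I_r.+1) -> bool}.

Lemma def_coded (b : 'I_m -> V) (w : option ('I_r.+1 * 'I_m) -> V) :
  definable_relation (fun M (e : V -> M) =>
    coded phi u nu (fun i => e (b i)) (fun j => e (w j))).
Proof.
rewrite /coded /realized_in /swappable_at /coloured /twisted /greedy_at /sim_at.
rewrite /lex_at /eqs_at /value_at /eq_at /le_at /prime_power /prime_element.
rewrite /divides.
by repeat (cbv beta; first [apply: def_same_set | definability_step]).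
Qed.

End CodeDefinability.

Ltac definability := repeat (cbv beta;
  first [apply: def_coded | apply: def_same_set | definability_step]).

(** * Codes in the standard model *)

Section StandardModel.
Implicit Types x y z : NatMul.

Lemma prime_of_site_subproof (s : site) : 0 < val s.
Proof. by rewrite prime_gt0 // (valP s). Qed.

Definition prime_of (s : site) : NatMul :=
  exist _ (val s) (prime_of_site_subproof s).

Lemma val_at_prime s t : val_at (prime_of s) t = (t == s).
Proof. by rewrite /val_at /= logn_prime ?(valP s) // (inj_eq val_inj). Qed.

Lemma prime_of_inj : injective prime_of.
Proof. by move=> s t /(congr1 val) /= /val_inj. Qed.

Lemma dividesP x y : divides x y <-> forall s, val_at x s <= val_at y s.
Proof.
split=> [[z <-] s|h]; first by rewrite val_at_mul leq_addr.
have [|z hz] := @val_at_surj (fun s => val_at y s - val_at x s).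
  by have [l hl] := val_at_fs y; exists l => s /hl ->.
by exists z; apply: val_at_inj => s; rewrite val_at_mul hz subnKC.
Qed.

Lemma val_at_eq1 x : (forall s, val_at x s = 0) -> x = sone NatMul.
Proof. by move=> h; apply: val_at_inj => s; rewrite h val_at_one. Qed.

Lemma prime_elementP (p : NatMul) : prime_element p <-> exists s, p = prime_of s.
Proof.
split=> [[p1 hp]|[s ->]].
  have [s hs] : exists s, val_at p s <> 0.
    apply: contrapT => /forallNP h; apply/p1/val_at_eq1 => s.
    exact: contrapT (h s).
  have /dividesP[z hz] : forall t, val_at (prime_of s) t <= val_at p t.
    move=> t; rewrite val_at_prime; case: eqP => // ->.
    by rewrite lt0n; apply/eqP.
  exists s; case: (hp _ _ hz) => e.
    by have := val_at_prime s s; rewrite e val_at_one eqxx.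
  rewrite -hz e; apply: val_at_inj => t.
  by rewrite val_at_mul val_at_one addn0.
split=> [e|x y e].
  by have := val_at_prime s s; rewrite e val_at_one eqxx.
have h t : val_at x t + val_at y t = (t == s).
  by rewrite -val_at_mul e val_at_prime.
have [x0|x0] := eqVneq (val_at x s) 0; [left|right]; apply: val_at_eq1 => t.
all: have := h t; case: eqP => [->|_] /=.
all: try by case: (val_at x t) (val_at y t) => [|?] [|?].
case: (val_at x s) x0 => // k _; rewrite addSn => -[] /eqP.
by rewrite addn_eq0 => /andP[_ /eqP].
Qed.

Lemma prime_of_prime s : prime_element (prime_of s).
Proof. by apply/prime_elementP; exists s. Qed.

Lemma prime_powerP s q :
  prime_power (prime_of s) q <-> forall t, t != s -> val_at q t = 0.
Proof.
rewrite /prime_power; split=> [h t ts|h d /prime_elementP[t ->] /dividesP/(_ t)].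
  apply/eqP; rewrite -leqn0 leqNgt; apply: contra ts => q0; apply/eqP.
  apply/prime_of_inj/h; first exact: prime_of_prime.
  by apply/dividesP => t'; rewrite val_at_prime; case: eqP => // ->.
rewrite val_at_prime eqxx => q0; congr prime_of; apply/eqP.
by apply: contraLR q0 => /h->.
Qed.

Lemma le_atP s x y : le_at (prime_of s) x y <-> val_at x s <= val_at y s.
Proof.
rewrite /le_at; split=> [h|h q /prime_powerP hq /dividesP qx].
  have [|q hq] := @val_at_surj (fun t => if t == s then val_at x s else 0).
    by exists [:: s] => t; rewrite inE => /negPf->.
  have /dividesP/(_ s) : divides q y.
    apply: h; first by apply/prime_powerP => t /negPf ts; rewrite hq ts.
    by apply/dividesP => t; rewrite hq; case: eqP => [->|].
  by rewrite hq eqxx.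
apply/dividesP => t; have [->|ts] := eqVneq t s; last by rewrite hq.
exact: leq_trans (qx s) h.
Qed.

Lemma eq_atP s x y : eq_at (prime_of s) x y <-> val_at x s = val_at y s.
Proof.
rewrite /eq_at !le_atP; split=> [[h1 h2]|->//].
by apply/eqP; rewrite eqn_leq h1.
Qed.

Lemma value_atP i s x : value_at i (prime_of s) x <-> val_at x s = i.
Proof.
have e : val_at (iter i (smul (prime_of s)) (sone NatMul)) s = i.
  elim: i => [|i IH]; first exact: val_at_one.
  by rewrite iterS val_at_mul IH val_at_prime eqxx.
split=> [[_ [-> /eq_atP]]|h]; first by rewrite e.
by eexists; split; [reflexivity|apply/eq_atP; rewrite e].
Qed.

End StandardModel.

Section Lexicographic.
Variable m : nat.
Implicit Types v w : 'I_m -> nat.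

Definition lex v w := exists i : 'I_m, v i < w i /\
  forall j : 'I_m, j < i -> v j = w j.

Lemma lex_asym v w : lex v w -> ~ lex w v.
Proof.
move=> [i [lti hi]] [j [ltj hj]].
case: (ltngtP i j) => [ij|ji|e].
- by rewrite hj // ltnn in lti.
- by rewrite hi // ltnn in ltj.
- by rewrite (val_inj e) in lti; have := ltn_trans lti ltj; rewrite ltnn.
Qed.

(** Coordinates are minimised one after the other: [R n v w] is the comparison
    of [v] and [w] restricted to the first [n] coordinates. *)
Lemma lex_least (A : ('I_m -> nat) -> Prop) : (exists v, A v) ->
  exists2 v, A v & forall w, A w -> w = v \/ lex v w.
Proof.
move=> A0.
pose R n v w := (forall i : 'I_m, i < n -> w i = v i) \/
  exists i : 'I_m, [/\ i < n, v i < w i & forall j : 'I_m, j < i -> v j = w j].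
suff [v [Av hv]] : exists v, A v /\ forall w, A w -> R m v w.
  exists v => // w /hv[e|[i [_ lti hi]]]; last by right; exists i.
  by left; apply/funext => i; apply: e.
suff main n : n <= m -> exists v, A v /\ forall w, A w -> R n v w.
  exact: main.
elim: n => [_|n IH nm].
  by case: A0 => v Av; exists v; split=> // w _; left.
have [v [Av hv]] := IH (ltnW nm); pose i0 := Ordinal nm.
pose P k := exists w, [/\ A w, forall i : 'I_m, i < n -> w i = v i & w i0 = k].
have ex : exists k, `[< P k >] by exists (v i0); apply/asboolP; exists v.
case: (ex_minnP ex) => k /asboolP[w [Aw ew wk]] kmin.
exists w; split=> // w' Aw'.
have [e|[i [ni lti hi]]] := hv w' Aw'; last first.
  right; exists i; split; [exact: ltnW|by rewrite ew|move=> j ji].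
  by rewrite ew ?hi // (ltn_trans ji).
have : k <= w' i0 by apply: kmin; apply/asboolP; exists w'.
rewrite leq_eqVlt => /orP[/eqP ek|kw].
  left=> i; rewrite ltnS leq_eqVlt => /orP[/eqP ein|ni]; last by rewrite e ?ew.
  by have -> : i = i0 by [apply: val_inj]; rewrite wk.
right; exists i0; split=> //=; first by rewrite wk.
by move=> j jn; rewrite ew ?e.
Qed.

Lemma zero_least v : v = (fun=> 0) \/ lex (fun=> 0) v.
Proof.
have [|w _ h] := @lex_least (fun=> True); first by exists v.
by have [e|[i []//]] := h (fun=> 0) I; rewrite e; apply: h.
Qed.

End Lexicographic.

Section Coding.
Variables (n m : nat) (phi : formula ('I_n + 'I_m)).
Local Notation zero := (fun _ : 'I_m => 0).
Local Notation fs := (finitely_supported zero).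
Implicit Types (b c : 'I_m -> NatMul) (s t : site).

Definition config b s : 'I_m -> nat := fun i => val_at (b i) s.

Lemma fs_config b : fs (config b).
Proof.
have /choice[l hl] : forall i : 'I_m, exists l : seq site,
    forall s, s \notin l -> val_at (b i) s = 0.
  by move=> i; have [l hl] := val_at_fs (b i); exists l.
exists (flatten [seq l i | i <- enum 'I_m]) => s sl; apply/funext => i.
apply: hl; apply: contra sl => sl; apply/flattenP; exists (l i) => //.
by apply/mapP; exists i; rewrite ?mem_enum.
Qed.

Lemma config_surj (a : site -> 'I_m -> nat) : fs a -> exists b, a = config b.
Proof.
case=> l hl.
have /choice[b hb] : forall i : 'I_m, exists x, forall s, val_at x s = a s i.
  by move=> i; apply: val_at_surj; exists l => s /hl ->.
by exists b; apply/funext => s; apply/funext => i; rewrite /config hb.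
Qed.

Lemma config_inj : injective config.
Proof.
move=> b c h; apply/funext => i; apply: val_at_inj => s.
exact: (congr1 (fun f => f s i) h).
Qed.

Lemma config_at s (v : 'I_m -> nat) : exists b, v = config b s.
Proof.
have [|b hb] := @config_surj (upd (fun=> zero) s v); last first.
  by exists b; rewrite -hb updE.
by apply: fs_upd; exists [::].
Qed.

(** [decode] extends the inverse of [config] to all functions, so that the
    relation below is an equivalence without any condition on the support. *)
Lemma decode_subproof (a : site -> 'I_m -> nat) :
  exists b, fs a -> a = config b.
Proof.
have [/config_surj[b hb]|h] := pselect (fs a); first by exists b.
by exists (fun=> sone NatMul).
Qed.

Definition decode a := sval (cid (decode_subproof a)).

Lemma configK b : decode (config b) = b.
Proof.
by apply/esym/config_inj/(svalP (cid (decode_subproof (config b))))/fs_config.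
Qed.

Definition same_set_config (a a' : site -> 'I_m -> nat) : Prop :=
  same_set phi (decode a) (decode a').

Local Notation E := same_set_config.

Lemma same_set_configE b c : E (config b) (config c) = same_set phi b c.
Proof. by rewrite /same_set_config !configK. Qed.

Lemma same_set_config_refl a : E a a.
Proof. by []. Qed.

Lemma same_set_config_sym a a' : E a a' -> E a' a.
Proof. by move=> h x; rewrite h. Qed.

Lemma same_set_config_trans a a' a'' : E a a' -> E a' a'' -> E a a''.
Proof. by move=> h h' x; rewrite h h'. Qed.

Lemma same_set_config_local :
  exists (C : finType) (cell : ('I_m -> nat) -> ('I_m -> nat) -> C) (K : nat),
  forall a a' a'' : site -> 'I_m -> nat, fs a -> fs a' -> fs a'' ->
    similar K (fun s => cell (a s) (a' s)) (fun s => cell (a s) (a'' s)) ->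
    E a a' -> E a a''.
Proof.
have [f hf] := def_same_set phi (fun i : 'I_m => inl i) (fun i : 'I_m => inr i).
have [C [cell [K h]]] := feferman_vaught f.
exists C, (fun v w => cell (join v w)), K => a a' a'' /config_surj[b ->].
move=> /config_surj[c ->] /config_surj[c' ->]; rewrite !same_set_configE => hs.
have localE d : local (join b d) = fun s => join (config b s) (config d s).
  by apply/funext => s; apply/funext => -[].
have fsj (d : 'I_m -> NatMul) : finitely_supported (fun=> 0) (local (join b d)).
  have [l hl] := fs_config b; have [l' hl'] := fs_config d.
  exists (l ++ l') => s; rewrite mem_cat negb_or localE => /andP[/hl-> /hl'->].
  by apply/funext => -[].
have := h (join b c) (join b c') (fsj _) (fsj _).
by rewrite !localE (hf _ (join b c)) (hf _ (join b c')); apply.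
Qed.

Lemma eqs_atP s b c : eqs_at (prime_of s) b c <-> config b s = config c s.
Proof.
split=> [h|h i]; last by apply/eq_atP/(congr1 (fun f => f i) h).
by apply/funext => i; apply/eq_atP.
Qed.

Lemma lex_atP s b c : lex_at (prime_of s) b c <-> lex (config b s) (config c s).
Proof.
split=> -[i [lti hi]]; exists i; split.
- by rewrite ltnNge; apply/negP => /le_atP.
- by move=> j /hi /eq_atP.
- by move=> /le_atP; rewrite leqNgt lti.
- by move=> j /hi e; apply/eq_atP.
Qed.

Lemma sim_atP b s v w : sim_at phi b (prime_of s) v w <->
  sim zero E (config b) s (config v s) (config w s).
Proof.
split=> h.
  move=> _ _ /config_surj[c ->] /config_surj[c' ->] off cv c'w.
  rewrite !same_set_configE; apply: h; try exact/eqs_atP.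
  move=> _ /prime_elementP[t ->] ts; apply/eqs_atP/off.
  by apply: contra_notN ts => /eqP->.
move=> c c' off /eqs_atP cv /eqs_atP c'w; rewrite -!same_set_configE.
apply: h => //; try exact: fs_config.
move=> t ts; apply/eqs_atP/off; first exact: prime_of_prime.
by move=> /prime_of_inj e; rewrite e eqxx in ts.
Qed.

Lemma greedy_atP r b s (g : 'I_r.+1 * 'I_m -> NatMul) :
  greedy_at phi b (prime_of s) g <->
  greedy zero (@lex m) (sim zero E (config b) s)
    (fun j => config (fun l => g (j, l)) s).
Proof.
split=> h j; case: (h j) => -[h1 h2]; [left|right|left|right]; split.
- by move=> i ij /sim_atP; apply: h1.
- move=> v; have [c ->] := config_at s v.
  by move=> /lex_atP/h2[i [ij /sim_atP hi]]; exists i.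
- move=> v; have [c ->] := config_at s v.
  by have [i [ij /sim_atP hi]] := h1 c; exists i.
- by apply/funext => l; apply/value_atP.
- by move=> i ij /sim_atP; apply: h1.
- by move=> v /lex_atP/h2[i ij hi]; exists i; split=> //; apply/sim_atP.
- move=> v; have [i ij hi] := h1 (config v s).
  by exists i; split=> //; apply/sim_atP.
- by move=> l; apply/value_atP; apply: (congr1 (fun f => f l) h2).
Qed.

Definition twist a k := if k == 0 then a else if k == a then 0 else k.

Lemma twistK a : involutive (twist a).
Proof.
move=> k; rewrite /twist; case: (k =P 0) => [->|/eqP k0].
  by rewrite eqxx; case: eqP.
case: (k =P a) => [->|/eqP ka] //=.
by rewrite (negPf k0) (negPf ka).
Qed.

Lemma twistedP a s x y :
  twisted a (prime_of s) x y <-> val_at y s = twist a (val_at x s).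
Proof.
rewrite /twisted !value_atP eq_atP /twist; split.
  case=> [[-> ->]//|[[-> ->]|[/eqP/negPf-> [/eqP/negPf->]]//]].
  by rewrite eqxx; case: eqP.
case: eqP => [|x0]; first by left.
by case: eqP => [|xa]; right; [left|right].
Qed.

Variable r : nat.
Variable u : 'I_r.+1 -> 'I_m -> nat.
Implicit Type w : option ('I_r.+1 * 'I_m) -> NatMul.

Definition colour_values w s (i : 'I_r.+1) : 'I_m -> nat :=
  fun l => twist (u i l) (val_at (w (Some (i, l))) s).

Lemma colouredP w i s c :
  coloured u w i (prime_of s) c <-> config c s = colour_values w s i.
Proof.
rewrite /coloured; split=> [h|h l].
  by apply/funext => l; apply/twistedP.
by apply/twistedP; apply: (congr1 (fun f => f l) h).
Qed.

Lemma swappable_atP b w s t :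
  swappable_at phi u b w (prime_of s) (prime_of t) <->
  swappable zero E (colour_values w) (config b) s t.
Proof.
split=> h i j.
  move=> _ _ /config_surj[c ->] /config_surj[c' ->] off h1 h2 h3 h4.
  rewrite !same_set_configE; apply: (h i j); try exact/colouredP.
  move=> _ /prime_elementP[p ->] ps pt; apply/eqs_atP/off.
    by apply: contra_notN ps => /eqP->.
  by apply: contra_notN pt => /eqP->.
move=> c c' off /colouredP h1 /colouredP h2 /colouredP h3 /colouredP h4.
rewrite -!same_set_configE; apply: (h i j) => //; try exact: fs_config.
move=> p ps pt; apply/eqs_atP/off; first exact: prime_of_prime.
  by move=> /prime_of_inj e; rewrite e eqxx in ps.
by move=> /prime_of_inj e; rewrite e eqxx in pt.
Qed.

Variable R : nat.

Lemma realized_inP (y J : NatMul) (y' : site -> 'I_R.+1)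
    (J' : site -> 'I_r.+1) (t : seq ('I_R.+1 * 'I_r.+1)) :
  (forall s, val_at y s = y' s) -> (forall s, val_at J s = J' s) ->
  realized_in y J t <-> realizes (fun s => (y' s, J' s)) t.
Proof.
move=> hy hJ; split.
  move=> [f [fprime [finj fval]]].
  have /choice[g hg] : forall i, exists s, f i = prime_of s.
    by move=> i; apply/prime_elementP.
  exists [seq g i | i <- enum 'I_(size t)].
    rewrite map_inj_uniq ?enum_uniq // => i j e; apply: contrapT => /eqP ij.
    by apply: (finj i j ij); rewrite !hg e.
  apply: (@eq_from_nth _ (ord0, ord0)).
    by rewrite 2!size_map size_enum_ord.
  rewrite 2!size_map size_enum_ord => i it.
  rewrite -map_comp (nth_map (Ordinal it)) ?size_enum_ord //=.
  have -> : nth (Ordinal it) (enum 'I_(size t)) i = Ordinal it.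
    by apply: val_inj; rewrite /= nth_enum_ord.
  case: (fval (Ordinal it)); rewrite hg => /value_atP/= e1 /value_atP/= e2.
  case: (nth _ t i) e1 e2 => a b /=; rewrite hy hJ => e1 e2.
  by congr (_, _); apply: val_inj.
case=> l ul <-; have [s0 _] := site_infinite [::].
exists (fun i => prime_of (nth s0 l i)).
split; first by move=> i; apply: prime_of_prime.
have sz (i : 'I_(size [seq (y' s, J' s) | s <- l])) : i < size l.
  by apply: leq_trans (ltn_ord i) _; rewrite size_map.
split=> [i j ij /prime_of_inj/eqP|i].
  by rewrite nth_uniq // => /eqP/val_inj/eqP; rewrite (negPf ij).
by rewrite (nth_map s0) //=; split; apply/value_atP.
Qed.

Variable k : nat.
Variable nu : {ffun k.-bseq ('I_R.+1 * 'I_r.+1) -> bool}.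

(** Reading a code site by site turns it into the lists of values, a labelling
    of the exchangeability classes, and a finite amount of information on a
    colouring. *)
Lemma codedP b w : coded phi u nu b w <->
  (forall s, greedy zero (@lex m) (sim zero E (config b) s)
               (colour_values w s)) /\
  exists y : site -> 'I_R.+1,
    [/\ forall s, val_at (w None) s = y s,
        labelling zero E (colour_values w) (config b) y &
        exists J, [/\ finitely_supported ord0 J,
          E (config b) (paint (colour_values w) J) &
          forall t : k.-bseq _, nu t <-> realizes (fun s => (y s, J s)) t]].
Proof.
split.
  move=> [hg [hl [hs [J [c [hJ [bc hnu]]]]]]]; split.
    move=> s.
    have [g [/(_ _)/colouredP e /greedy_atP]] := hg _ (prime_of_prime s).
    by rewrite (_ : (fun j => _) = colour_values w s) //; apply/funext.
  have /choice[y hy] : forall s, exists l : 'I_R.+1, val_at (w None) s = l.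
    by move=> s; have [l /value_atP] := hl _ (prime_of_prime s); exists l.
  have /choice[J' hJ'] : forall s, exists i : 'I_r.+1,
      val_at J s = i /\ config c s = colour_values w s i.
    move=> s; have [i [/value_atP h1 /colouredP h2]] := hJ _ (prime_of_prime s).
    by exists i.
  exists y; split=> //.
    move=> p q pq; rewrite -swappable_atP -hs; do ?exact: prime_of_prime.
      split=> [e|[l [/value_atP e1 /value_atP e2]]].
        by exists (y q); split; apply/value_atP; rewrite hy ?e.
      by apply: val_inj; rewrite /= -!hy e1.
    by move=> /prime_of_inj e; rewrite e eqxx in pq.
  exists J'; split.
  - have [l hl'] := val_at_fs J; exists l => s /hl' J0; apply: val_inj.
    by case: (hJ' s) => e _; rewrite /= -e.
  - rewrite (_ : paint _ _ = config c) ?same_set_configE //.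
    by apply/funext => s; case: (hJ' s).
  - by move=> t; rewrite hnu; apply: realized_inP => // s; case: (hJ' s).
move=> [hg [y [hy hl [J [fJ EJ hnu]]]]].
have zeta0 s : colour_values w s ord0 = zero.
  have := greedy_ord0 (@zero_least m) (hg s). exact.
have [c hc] := config_surj (fs_paint zeta0 fJ).
have [J' hJ'] : exists x, forall s, val_at x s = J s.
  by apply: val_at_surj; case: fJ => l hl'; exists l => s /hl' ->.
split.
  move=> _ /prime_elementP[s ->].
  have /choice[g hgs] : forall i, exists c, colour_values w s i = config c s.
    by move=> i; apply: config_at.
  exists (fun il => g il.1 il.2); split; first by move=> i; apply/colouredP.
  apply/greedy_atP => /=; rewrite (_ : (fun j => _) = colour_values w s) //.
  by apply/funext => i; rewrite hgs.
split; first by move=> _ /prime_elementP[s ->]; exists (y s); apply/value_atP.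
split.
  move=> _ _ /prime_elementP[p ->] /prime_elementP[q ->] pq.
  rewrite swappable_atP -hl; last by apply: contra_not_neq pq => ->.
  split=> [[l [/value_atP e1 /value_atP e2]]|e].
    by apply: val_inj; rewrite /= -!hy e1.
  by exists (y q); split; apply/value_atP; rewrite hy ?e.
exists J', c; split.
  move=> _ /prime_elementP[s ->]; exists (J s); split; first exact/value_atP.
  by apply/colouredP; rewrite -hc.
split; first by rewrite -same_set_configE -hc.
by move=> t; rewrite hnu; apply: iff_sym; apply: realized_inP.
Qed.

End Coding.

Section StandardCoding.
Variables (n m : nat) (phi : formula ('I_n + 'I_m)).
Local Notation zero := (fun _ : 'I_m => 0).
Local Notation fs := (finitely_supported zero).
Local Notation E := (same_set_config phi).
Variables (C : finType) (cell : ('I_m -> nat) -> ('I_m -> nat) -> C) (K : nat).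
Hypothesis E_local : forall a a' a'' : site -> 'I_m -> nat,
    fs a -> fs a' -> fs a'' ->
    similar K (fun s => cell (a s) (a' s)) (fun s => cell (a s) (a'' s)) ->
    E a a' -> E a a''.

Local Notation r := #|C|.
Local Notation R := (#|{: {ffun 'I_r.+1 -> C}}|).
Local Notation k := (threshold C K).
Local Notation code := (option ('I_r.+1 * 'I_m) -> NatMul).
Local Notation realized := {ffun k.-bseq ('I_R.+1 * 'I_r.+1) -> bool}.
Local Notation greedy b s := (greedy zero (@lex m) (sim zero E (config b) s)).

Lemma colour_values_surj (u : 'I_r.+1 -> 'I_m -> nat) (y : site -> nat)
    (zeta : site -> 'I_r.+1 -> 'I_m -> nat) :
  finitely_supported 0 y -> finitely_supported u zeta ->
  exists w, colour_values u w = zeta /\ forall s, val_at (w None) s = y s.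
Proof.
move=> /val_at_surj[y' hy'] [l hl].
have /choice[z hz] : forall il : 'I_r.+1 * 'I_m, exists x, forall s,
    val_at x s = twist (u il.1 il.2) (zeta s il.1 il.2).
  move=> il; apply: val_at_surj; exists l => s /hl ->.
  by rewrite /twist eqxx; case: eqP.
exists (fun o => if o is Some il then z il else y'); split=> //.
apply/funext => s; apply/funext => i; apply/funext => j.
by rewrite /colour_values hz twistK.
Qed.

Lemma colour_values_inj u (w w' : code) :
  colour_values u w = colour_values u w' ->
  val_at (w None) =1 val_at (w' None) -> w = w'.
Proof.
move=> e eN; apply/funext => -[[i j]|]; last exact: val_at_inj.
apply: val_at_inj => s; apply: (can_inj (@twistK (u i j))).
exact: (congr1 (fun f => f s i j) e).
Qed.

Lemma greedy_cells b s (z : 'I_r.+1 -> 'I_m -> nat) : greedy b s z ->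
  forall v, exists j, sim zero E (config b) s v (z j).
Proof.
apply: (@greedy_cover _ _ _ _ (cell (config b s))) => //.
by move=> v w; apply: (sim_cell E_local); apply: fs_config.
Qed.

(** The index [o] and the bits [nu] range over finite types.  Outside the
    support of [b] all the lists are equal, and their entries are zero or least
    in their cells for [cell zero], so that [o] only has to name cells. *)
Lemma code_exists :
  exists U : {ffun 'I_r.+1 -> option C} -> 'I_r.+1 -> 'I_m -> nat,
  forall b : 'I_m -> NatMul,
    exists o (nu : realized) (w : code), coded phi (U o) nu b w.
Proof.
have [mu hmu] := cell_least zero (@lex_least m) (cell zero).
exists (fun o i => if o i is Some c then mu c else zero) => b.
have /choice[zeta hzeta] : forall s, exists z : 'I_r.+1 -> _, greedy b s z.
  by move=> s; apply: greedy_exists; [exact: lex_least|exact: lex_asym].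
have cover := fun p => greedy_cells (hzeta p).
have zeta0 s : zeta s ord0 = zero.
  by have := greedy_ord0 (@zero_least m) (hzeta s); exact.
have [l hl] := fs_config b; have [s0 s0l] := site_infinite l.
have b0 := hl s0 s0l.
have generic s : config b s = zero -> zeta s = zeta s0.
  move=> bs; have es : config b s = config b s0 by rewrite bs b0.
  have := hzeta s; rewrite (sim_generic E_local (fs_config b) es) => h.
  exact: (greedy_unique (@lex_least m) (@lex_asym m) (@zero_least m) h).
have /choice[o ho] : forall i, exists c : option C,
    zeta s0 i = if c is Some c then mu c else zero.
  move=> i; have [||||->|/hmu ->] := @greedy_cell_least _ zero (@lex m) _
    (cell zero) (sim zero E (config b) s0) _ _ _ _ (zeta s0) i.
  - exact: sim_sym.
  - exact: sim_trans.
  - by move=> v w e; apply: (sim_cell E_local); rewrite ?b0 //; apply: fs_config.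
  - exact: hzeta.
  - by exists None.
  - by exists (Some (cell zero (zeta s0 i))).
have [y fy hy] :=
  labelling_exists site_infinite E_local (fs_config b) cover generic.
have [J fJ EJ] :=
  painted (@same_set_config_refl _ _ phi) zeta0 (fs_config b) cover.
pose u := fun i => if [ffun i => o i] i is Some c then mu c else zero.
have [||w [hw hwN]] := @colour_values_surj u (fun s => y s) zeta.
- by case: fy => l' hl'; exists l' => s /hl' ->.
- by exists l => s /hl /generic ->; apply/funext => i; rewrite ho /u ffunE.
exists [ffun i => o i].
exists [ffun t : k.-bseq _ => `[< realizes (fun s => (y s, J s)) t >]], w.
apply/codedP; rewrite -/u hw; split=> //; exists y; split=> //.
by exists J; split=> // t; rewrite ffunE; split=> /asboolP.
Qed.

Lemma code_determines u (nu : realized) (b b' : 'I_m -> NatMul) (w : code) :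
  coded phi u nu b w -> coded phi u nu b' w -> same_set phi b b'.
Proof.
move=> /codedP[hg [y [hy hl [J [fJ EJ hnu]]]]].
move=> /codedP[_ [y' [hy' hl' [J' [fJ' EJ' hnu']]]]].
have ey : y' = y by apply/funext => s; apply: val_inj; rewrite /= -hy -hy'.
rewrite {}ey {y'} in hy' hl' hnu'.
have zeta0 s : colour_values u w s ord0 = zero.
  by have := greedy_ord0 (@zero_least m) (hg s); exact.
rewrite -same_set_configE.
apply: (E_of_similar site_infinite _ _ _ E_local zeta0 (fs_config b)
  (fs_config b') hl hl' fJ fJ' EJ EJ').
- exact: same_set_config_refl.
- exact: same_set_config_sym.
- exact: same_set_config_trans.
move=> t ht; have e : t = Bseq ht by [].
by rewrite e -hnu -hnu'.
Qed.

(** The lists of values and the exchangeability classes only depend on the class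
    of [b], so that codes of its members only differ by the choice of the
    labels: [g] gives the labels of a fixed family of representatives. *)
Lemma code_bounded u (nu : realized) (b : 'I_m -> NatMul) :
  exists F : {ffun 'I_R.+1 -> 'I_R.+1} -> code,
  forall b' w, same_set phi b b' -> coded phi u nu b' w -> exists g, w = F g.
Proof.
have /choice[zeta hzeta] : forall s, exists z : 'I_r.+1 -> _, greedy b s z.
  by move=> s; apply: greedy_exists; [exact: lex_least|exact: lex_asym].
have [F0 hF0] := labelling_bounded site_infinite E_local zeta
  [the finType of 'I_R.+1] (fs_config b).
have /choice[F hF] : forall g, exists w : code, forall w',
    colour_values u w' = zeta ->
    (forall s, val_at (w' None) s = F0 g s) -> w' = w.
  move=> g; have [[w0 [h0 h0']]|no] := pselect (exists w0 : code,
    colour_values u w0 = zeta /\ forall s, val_at (w0 None) s = F0 g s).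
    exists w0 => w' h h'; apply: (@colour_values_inj u); first by rewrite h h0.
    by move=> s; rewrite h' h0'.
  by exists (fun=> sone NatMul) => w' h h'; case: no; exists w'.
exists F => b' w; rewrite -same_set_configE => bb' /codedP[hg [y [hy hl _]]].
have symE := @same_set_config_sym _ _ phi.
have transE := @same_set_config_trans _ _ phi.
have simE := sim_congr zero symE transE bb'.
have e : colour_values u w = zeta.
  apply/funext => s; have := hg s; rewrite -simE => h.
  exact: (greedy_unique (@lex_least m) (@lex_asym m) (@zero_least m) h).
have [|g hgy] := hF0 y.
  rewrite e in hl; move=> p q /hl ->.
  by rewrite (swappable_congr _ symE transE _ bb').
by exists g; apply: hF => // s; rewrite hy hgy.
Qed.

End StandardCoding.

(** * Weak elimination of imaginaries *)

Lemma transfer (M : structure) (P : structure -> Prop) :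
  definable_relation (V := void) (fun N _ => P N) ->
  models M skolem_arithmetic -> P NatMul -> P M.
Proof.
case=> f hf hM hN; apply/(hf M (fun v : void => match v with end))/hM.
exact/hf.
Qed.

(** The length of the codes, their indices [I] and the bound [G] on the number
    of codes with a given index only depend on [phi], so that each of the three
    properties is expressed by a sentence and can be transferred. *)
Lemma uniform_coding n m (phi : formula ('I_n + 'I_m)) :
  exists (r R k : nat) (I G : finType) (U : I -> 'I_r.+1 -> 'I_m -> nat)
    (nu : I -> {ffun k.-bseq ('I_R.+1 * 'I_r.+1) -> bool}),
  forall M : structure, models M skolem_arithmetic ->
  [/\ forall b : 'I_m -> M, exists i, exists w : option _ -> M,
        coded phi (U i) (nu i) b w,
      forall i (b b' : 'I_m -> M) (w : option _ -> M),
        coded phi (U i) (nu i) b w -> coded phi (U i) (nu i) b' w ->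
        same_set phi b b' &
      forall i (b : 'I_m -> M), exists F : G * option ('I_r.+1 * 'I_m) -> M,
        forall (b' : 'I_m -> M) (w : option _ -> M), same_set phi b b' ->
          coded phi (U i) (nu i) b' w -> exists g, forall x, w x = F (g, x)].
Proof.
have [C [cell [K E_local]]] := same_set_config_local phi.
have [U hU] := code_exists E_local.
pose r := #|C|; pose R := #|{: {ffun 'I_r.+1 -> C}}|; pose k := threshold C K.
exists r, R, k, ({ffun 'I_r.+1 -> option C} *
  {ffun k.-bseq ('I_R.+1 * 'I_r.+1) -> bool})%type.
exists {ffun 'I_R.+1 -> 'I_R.+1}, (fun i => U i.1), (fun i => i.2) => M hM.
split.
- apply: (@transfer M (fun N => forall b : 'I_m -> N, exists i,
    exists w : option _ -> N, coded phi (U i.1) i.2 b w) _ hM).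
    by definability.
  by move=> b; have [o [nu [w hw]]] := hU b; exists (o, nu), w.
- apply: (@transfer M (fun N => forall i (b b' : 'I_m -> N) (w : option _ -> N),
    coded phi (U i.1) i.2 b w -> coded phi (U i.1) i.2 b' w ->
    same_set phi b b') _ hM).
    by definability.
  by move=> i b b' w; apply: (code_determines E_local).
- apply: (@transfer M (fun N => forall i (b : 'I_m -> N),
    exists F : {ffun _ -> _} * option (_ * 'I_m) -> N,
    forall (b' : 'I_m -> N) (w : option _ -> N), same_set phi b b' ->
      coded phi (U i.1) i.2 b' w -> exists g, forall x, w x = F (g, x)) _ hM).
    by definability.
  move=> i b; have [F hF] := code_bounded E_local (U i.1) i.2 b.
  by exists (fun gx => F gx.1 gx.2) => b' w bb' /(hF _ _ bb')[g ->]; exists g.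
Qed.

Lemma definable_fiber (M : structure) n (D : set ('I_n -> M)) :
  definable [set: M] D ->
  exists m (phi : formula ('I_n + 'I_m)) (b : 'I_m -> M),
    D = [set x | sat (join x b) phi].
Proof.
case=> f ->.
have one : [set: M] by apply: SigSub (mem_set (I : [set: M] (sone M))).
have [W [g [f' h]]] := formula_support (inr one : 'I_n + [set: M]) f.
exists #|W|, (rename f' (fun w => match g w with
  | inl i => inl i | inr _ => inr (enum_rank w) end)).
exists (fun k => if g (enum_val k) is inr p then set_val p else sone M).
apply/funext => x; apply/propext; rewrite /= h sat_rename.
set e1 := (fun _ => _); set e2 := (fun _ => _).
rewrite (_ : e1 = e2) //; apply/funext => w; rewrite /e1 /e2.
by case gw: (g w) => [i|p] //=; rewrite enum_rankK gw.
Qed.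

Lemma sat_automorphism (M : structure) (s : M -> M) V (f : formula V)
    (e : V -> M) :
  automorphism s -> sat e f <-> sat (s \o e) f.
Proof.
move=> [[s' sK s'K] s1 sM].
have evalE U (e' : U -> M) t : eval (s \o e') t = s (eval e' t).
  by elim: t => //= t1 -> t2 ->; rewrite sM.
elim: f e => {V} [V t1 t2|V f IH|V f1 IH1 f2 IH2|V f IH] e /=.
- by rewrite !evalE; split=> [->//|/(can_inj sK)].
- by rewrite IH.
- by rewrite IH1 IH2.
have aux x : scons (s x) (s \o e) = s \o scons x e by apply/funext => -[].
split=> -[x]; first by move=> /IH hx; exists (s x); rewrite aux.
by rewrite -(s'K x) aux => /(proj2 (IH _)); exists (s' x).
Qed.

Lemma definable_automorphism (M : structure) (s : M -> M) V R (e : V -> M) :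
  automorphism s -> definable_relation R -> R M e -> R M (s \o e).
Proof. by move=> hs [f hf] /hf; rewrite (sat_automorphism f e hs) => /hf. Qed.

(** Moving the parameters by [s] moves the set that they define by [s]. *)
Lemma same_set_automorphism (M : structure) (s : M -> M) n m
    (phi : formula ('I_n + 'I_m)) (b : 'I_m -> M) :
  automorphism s -> fixes_setwise s [set x | sat (join x b) phi] ->
  same_set phi b (s \o b).
Proof.
move=> hs hD; have [[s' sK s'K] _ _] := hs.
have joinE y : join (s \o y) (s \o b) = s \o join y b by apply/funext => -[].
move=> x; have -> : x = s \o (s' \o x) by apply/funext => i /=; rewrite s'K.
set y := s' \o x; rewrite joinE -(sat_automorphism phi _ hs); split=> [hx|hy].
  have : [set x | sat (join x b) phi] (s \o y) by [].
  rewrite -hD => -[z hz /= e].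
  rewrite (_ : y = z) //; apply/funext => i; apply: (can_inj sK).
  by have := congr1 (@^~ i) e.
suff : [set x | sat (join x b) phi] (s \o y) by [].
by rewrite -hD; exists y.
Qed.

Lemma automorphism_inverse (M : structure) (s : M -> M) : automorphism s ->
  exists2 s', automorphism s' & cancel s s' /\ cancel s' s.
Proof.
move=> [[s' sK s'K] s1 sM]; exists s' => //; split; first by exists s.
  by rewrite -{1}s1 sK.
by move=> x y; apply: (can_inj sK); rewrite sM !s'K.
Qed.

Theorem theorem4p9 (mu : Type) (M : structure) :
  infinite_set [set: mu] -> monster mu M -> weak_elimination_of_imaginaries M.
Proof.
move=> _ [hM _ _ _] n D /definable_fiber[m [phi [b ->]]].
have [r [R [k [I [G [U [nu /(_ M hM)[T1 T2 T3]]]]]]]] := uniform_coding phi.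
have [i [w bw]] := T1 b.
pose X : set M := [set a | exists b' (w' : option _ -> M) o,
  [/\ same_set phi b b', coded phi (U i) (nu i) b' w' & w' o = a]].
have wX o : w o \in X by apply/mem_set; exists b, w, o.
exists X; split.
- have [F hF] := T3 i b.
  apply: (@sub_finite_set _ _ (range F)); last first.
    by apply: finite_image; apply: finite_finset.
  move=> a [b' [w' [o [bb' /(hF _ _ bb')[g hg] <-]]]].
  by exists (g, o); rewrite // hg.
- have [f hf] : definable_relation (V := 'I_n + X) (fun N e =>
      exists b' : 'I_m -> N,
        coded phi (U i) (nu i) b' (fun o => e (inr (SigSub (wX o)))) /\
        sat (join (fun j => e (inl j)) b') phi).
    apply: def_ex_tuple; apply: def_and; first exact: def_coded.
    apply: def_ext (def_sat phi (join (fun j => inl (inl j)) inr)) => N e.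
    rewrite (_ : join _ _ = fun v => e (join (fun j => inl (inl j)) inr v)) //.
    by apply/funext => -[].
  exists f; apply/funext => x; apply/propext; rewrite /= hf /=; split=> [hx|].
    by exists b.
  by move=> [b' [b'w hx]]; apply/(T2 i b b' w).
have sub s : automorphism s -> fixes_setwise s [set x | sat (join x b) phi] ->
    s @` X `<=` X.
  move=> hs /(same_set_automorphism hs) bsb a0.
  move=> [a [b' [w' [o [bb' b'w' <-]]]] <-].
  exists (s \o b'), (s \o w'), o; split=> //.
    have def_R :=
      def_same_set phi (fun j : 'I_m => inl j) (fun j : 'I_m => inr j).
    have bb2 := definable_automorphism (e := join b b') hs def_R bb'.
    by move=> x; rewrite bsb; apply: bb2.
  have def_R := def_coded phi (U i) (nu i) inl inr.
  exact: (definable_automorphism (e := join b' w') hs def_R b'w').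
move=> s hs hD; apply/seteqP; split; first exact: sub.
have [s' hs' [sK s'K]] := automorphism_inverse hs.
have hD' : fixes_setwise s' [set x | sat (join x b) phi].
  rewrite /fixes_setwise -{1}hD; apply/seteqP; split=> x /=.
    move=> [_ [y hy <-] <-]; rewrite (_ : _ \o _ = y) //.
    by apply/funext => j /=; rewrite sK.
  move=> hx; exists (s \o x); first by exists x.
  by apply/funext => j /=; rewrite sK.
move=> a aX; exists (s' a); last exact: s'K.
by apply: (sub s' hs' hD'); exists a.
Qed.
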